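(* Let $\alpha_i>-1$ for $i\in\{1,2,\dots,d\}$. Then the zeros of the function $z\mapsto\mathcal{J}_{\alpha}'(z)$ are interlaced with those of the function $z\mapsto\mathcal{J}_{\alpha}(z)$.
   Context: Here $d\ge 1$ is an integer, $\alpha_1,\dots,\alpha_d$ are real parameters, and $\alpha$ abbreviates the array $(\alpha_1,\dots,\alpha_d)$. The normalized hyper-Bessel function is the entire function $$\mathcal{J}_{\alpha}(z)=\sum_{n\ge 0}\frac{(-1)^n}{n!\,(\alpha_1+1)_n\cdots(\alpha_d+1)_n}\left(\frac{z}{d+1}\right)^{n(d+1)},$$ where $(\beta)_0=1$ and $(\beta)_n=\beta(\beta+1)\cdots(\beta+n-1)$ for $n\ge1$, and $\mathcal{J}_{\alpha}'$ denotes its derivative with respect to $z$. *)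

(* Defs.v *)
From HB Require Import structures.
From mathcomp Require Import all_boot all_order all_algebra.
From mathcomp Require Import complex.
From mathcomp Require Import all_classical all_reals all_analysis.

Set Implicit Arguments.
Unset Strict Implicit.
Unset Printing Implicit Defensive.

Import Order.TTheory GRing.Theory Num.Theory.
Import numFieldNormedType.Exports.

Local Open Scope classical_set_scope.
Local Open Scope complex_scope.
Local Open Scope ring_scope.

Definition pochhammer (R : realType) (b : R) (n : nat) : R :=
  \prod_(k < n) (b + k%:R).

Definition hyperBessel_coef (R : realType) (d : nat) (alpha : 'I_d -> R)
    (n : nat) : R :=
  (-1) ^+ n / (n`!%:R * \prod_(i < d) pochhammer (alpha i + 1) n).

(* [R[i]^o] is the complex field as a normed space over itself, so the limit
   below is for the modulus and [derive1 (hyperBessel alpha)] is the complex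
   derivative. *)
Definition hyperBessel (R : realType) (d : nat) (alpha : 'I_d -> R)
    (z : R[i]^o) : R[i]^o :=
  limn (series (fun n : nat =>
    ((hyperBessel_coef alpha n)%:C * (z / d.+1%:R) ^+ (n * d.+1) : R[i]^o))).

Definition zeros (R : realType) (f : R[i]^o -> R[i]^o) : set R[i] :=
  [set z | f z = 0].

Definition consecutive (R : realType) (A : set R) (x y : R) : Prop :=
  [/\ A x, A y, x < y & forall t, x < t < y -> ~ A t].

(* Points are counted without multiplicity: the zero of the derivative at the
   origin has multiplicity [d]. *)
Definition interlaced (R : realType) (A B : set R) : Prop :=
  [/\ A `&` B = set0,
      forall x y, consecutive A x y -> exists! t, x < t < y /\ B t &
      forall x y, consecutive B x y -> exists! t, x < t < y /\ A t].

(* Interlacing needs an order, and the zeros of [hyperBessel alpha] are not real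
   in general: the function depends only on [z ^+ d.+1], so its zero set is
   invariant under multiplication by the [d.+1]-th roots of unity.
   [interlaced_on_lines m A B] says that [A] and [B] are contained in the real
   lines through the origin directed by the [m]-th roots of unity, and that on
   each of these lines they are interlaced. For [m = 2] the only line is the
   real axis. *)
Definition interlaced_on_lines (R : realType) (m : nat) (A B : set R[i]) : Prop :=
  (forall z, (A `|` B) z -> exists (t : R) (w : R[i]), w ^+ m = 1 /\ z = t%:C * w)
  /\ (forall w : R[i], w ^+ m = 1 ->
        interlaced [set t : R | A (t%:C * w)] [set t : R | B (t%:C * w)]).

(* Main.v *)
(* Put m = d + 1 and u = (z/m)^m: then J(z) = f(u) with f(u) = sum_n a_n u^n, and
   J'(z) = (z/m)^d f'(u). With theta = u d/du, everything follows from these facts.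

   - f is a limit of polynomials P_N all of whose zeros are positive. Indeed
     p |-> p + theta(p)/c (c > 0) preserves this property, by looking at the
     logarithmic derivative as in the Gauss-Lucas theorem, and it multiplies the
     n-th coefficient by 1 + n/c. Apply it for c = alpha_i + 1 + k, k <= N, to
     (1 - u/(N+1)^(d+1))^(N+1); Euler's product for the Gamma function gives
     P_N -> f, and Tannery's theorem allows to pass to the limit.

   - Writing p = prod (1 - w u), one has for x >= 0, with s = sum w,
       (1 + x s)^2 ((theta p)^2 - p theta^2 p) >= x s p^2   at x,
       |p(x + iy)|^2 >= p(x)^2 + y^2 (p'^2 - p p'')(x),
     and both inequalities survive in the limit.

   - By the first one a double zero x > 0 of f_alpha would also be a double zero
     of f_(alpha + e_1), hence a zero of f_(alpha + k e_1) for all k; but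
     f_(alpha + k e_1)(x) -> 1. So the real zeros of f are simple, and by the second
     inequality f has no nonreal ones. This also applies to f', which is a
     multiple of f_(alpha + 1).

   - By the first one theta f / f is strictly decreasing on [0, +oo[ off the zeros
     of f, so two zeros of theta f enclose a zero of f; the converse is Rolle. *)
Require Import Defs.
From mathcomp Require Import all_boot all_order all_algebra.
From mathcomp Require Import complex ring lra.
From mathcomp Require Import all_classical all_reals all_analysis.
Import Order.TTheory GRing.Theory Num.Theory.
Import numFieldNormedType.Exports.
Set Implicit Arguments.
Unset Strict Implicit.
Unset Printing Implicit Defensive.
Local Open Scope classical_set_scope.
Local Open Scope complex_scope.
Local Open Scope ring_scope.

(** * Polynomials with positive zeros *)

Section PositiveRoots.
Variable R : realType.
Implicit Types (p : {poly R}) (ws : seq R) (c x y : R) (z : R[i]).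

Local Notation toC := (map_poly (real_complex R)).

(** The parameters are the reciprocals of the zeros, which normalizes the value at 0 to 1. *)
Definition linprod ws : {poly R} := \prod_(w <- ws) (1 - w *: 'X).

Definition positive_rooted p := exists2 ws, all (> 0) ws & p = linprod ws.

Definition polar c p : {poly R} := p + c^-1 *: ('X * p^`()).

Lemma Re_sum I (r : seq I) (F : I -> R[i]) :
  complex.Re (\sum_(i <- r) F i) = \sum_(i <- r) complex.Re (F i).
Proof. by apply: (big_morph (@complex.Re R)) => [[? ?] [? ?]|]. Qed.

Lemma Im_sum I (r : seq I) (F : I -> R[i]) :
  complex.Im (\sum_(i <- r) F i) = \sum_(i <- r) complex.Im (F i).
Proof. by apply: (big_morph (@complex.Im R)) => [[? ?] [? ?]|]. Qed.

Lemma linprod_cons w ws : linprod (w :: ws) = (1 - w *: 'X) * linprod ws.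
Proof. exact: big_cons. Qed.

Lemma horner_linprod0 ws : (linprod ws).[0] = 1.
Proof.
elim: ws => [|w ws IH]; first by rewrite /linprod big_nil hornerC.
by rewrite linprod_cons hornerM IH !hornerE; ring.
Qed.

Lemma coef_polar c p n : (polar c p)`_n = (1 + n%:R / c) * p`_n.
Proof.
rewrite /polar coefD coefZ coefXM; case: n => [|n] /=.
  by rewrite mul0r addr0 mulr0 addr0 mul1r.
by rewrite coef_deriv -mulr_natl; ring.
Qed.

Lemma map_linear_factor w : toC (1 - w *: 'X) = 1 - w%:C *: 'X.
Proof. by rewrite rmorphB rmorph1 /= map_polyZ map_polyX. Qed.

Lemma horner_linprodC_cons w ws z :
  (toC (linprod (w :: ws))).[z] = (1 - w%:C * z) * (toC (linprod ws)).[z].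
Proof.
by rewrite linprod_cons rmorphM /= map_linear_factor !hornerE.
Qed.

(** The logarithmic derivative of the product, multiplied by z; it turns the equation for a zero of
    [polar c p] into one on a sum over the zeros of p. *)
Lemma deriv_linprodC ws z :
  all (fun w : R => 1 - w%:C * z != 0) ws ->
  (toC ('X * (linprod ws)^`())).[z] =
  (toC (linprod ws)).[z] * \sum_(w <- ws) - (w%:C * z / (1 - w%:C * z)).
Proof.
elim: ws => [|w ws IH] /= => [_|/andP[wz /IH {}IH]].
  by rewrite /linprod !big_nil derivC mulr0 map_polyC/= hornerC mulr0.
rewrite horner_linprodC_cons big_cons.
have -> : 'X * (linprod (w :: ws))^`() =
    (- w *: 'X) * linprod ws + (1 - w *: 'X) * ('X * (linprod ws)^`()).
  rewrite linprod_cons derivM derivB derivC derivZ derivX -!mul_polyC polyCN; ring.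
move: ('X * _) IH => Q IH; rewrite rmorphD !rmorphM !hornerD !hornerM /= IH.
rewrite rmorphB rmorph1/= !map_polyZ map_polyX !hornerE rmorphN/=.
by field.
Qed.

Lemma linprodC_neq0 ws z :
  (toC (linprod ws)).[z] != 0 -> all (fun w : R => 1 - w%:C * z != 0) ws.
Proof.
elim: ws => //= w ws IH; rewrite horner_linprodC_cons mulf_eq0 negb_or.
by case/andP => -> /IH.
Qed.

Lemma linprodC_eq0 ws z : (toC (linprod ws)).[z] = 0 -> 
  exists2 w, w \in ws & 1 - w%:C * z = 0.
Proof.
elim: ws => [|w ws IH]; first by rewrite /linprod big_nil rmorph1 hornerC => /eqP;
  rewrite oner_eq0.
rewrite horner_linprodC_cons => /eqP; rewrite mulf_eq0 => /orP[/eqP e|/eqP /IH[v vw e]].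
  by exists w => //; rewrite mem_head.
by exists v => //; rewrite in_cons vw orbT.
Qed.

(** For w > 0 and y nonzero the sign is opposite to that of y, whatever w is; this excludes nonreal
    zeros. *)
Lemma Im_summand w x y :
  complex.Im (- (w%:C * (x +i* y) / (1 - w%:C * (x +i* y)))) =
  - y * (w / ((1 - w * x) ^+ 2 + (w * y) ^+ 2)).
Proof. by simpc => /=; rewrite sqrrN; ring. Qed.

Lemma positive_rooted_of_roots p :
  p.[0] = 1 -> (forall z, (toC p).[z] = 0 -> exists2 x, 0 < x & z = x%:C) ->
  positive_rooted p.
Proof.
move=> p0 pz; have [rs prs] := closed_field_poly_normal (toC p).
have p0C : (toC p).[0] = 1 by rewrite -(rmorph0 (real_complex R)) horner_map p0 rmorph1.
have lc0 : lead_coef (toC p) != 0.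
  by rewrite lead_coef_eq0; apply: contra_eq_neq p0C => ->; rewrite horner0 eq_sym oner_eq0.
move: (lead_coef _) prs lc0 => l prs l0.
have {}pz : forall z, z \in rs -> exists2 x, 0 < x & z = x%:C.
  move=> z zrs; apply: pz; apply/eqP; rewrite -/(root _ _) prs rootZ //.
  by rewrite root_prod_XsubC.
exists [seq (complex.Re z)^-1 | z <- rs].
  by rewrite all_map; apply/allP => z /pz [x x0 ->] /=; rewrite invr_gt0.
apply: (@map_poly_inj _ _ (real_complex R)); rewrite prs.
(* The normalization p(0) = 1 lets each factor X - z be divided by -z, which turns it into 1 - X /
   z, with nothing left of the leading coefficient. *)
have p1 : l * \prod_(z <- rs) (- z) = 1.
  apply: etrans p0C; rewrite prs hornerZ horner_prod; congr (_ * _).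
  by apply: eq_bigr => z _; rewrite hornerXsubC sub0r.
apply: etrans (scale1r _); rewrite -p1 -scalerA; congr (_ *: _).
rewrite /linprod rmorph_prod big_map -mul_polyC rmorph_prod -big_split /=.
apply: eq_big_seq => z /pz [x x0 ->] /=.
rewrite map_linear_factor -mul_polyC mulrBr mulr1 mulrA -polyCM.
by rewrite mulNr fmorphV mulfV ?fmorph_eq0 ?gt_eqF// !polyCN polyC1 mulN1r opprK addrC.
Qed.

Lemma polar_positive_rooted c p :
  0 < c -> positive_rooted p -> positive_rooted (polar c p).
Proof.
move=> c0 [ws ws0 ->{p}]; apply: positive_rooted_of_roots.
  by rewrite /polar hornerD hornerZ hornerM hornerX mul0r mulr0 addr0 horner_linprod0.
move=> z; rewrite /polar rmorphD /= hornerD map_polyZ hornerZ /=.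
(* The common zeros with p are the positive numbers 1 / w; only zeros z with p(z) nonzero remain. *)
have [/linprodC_eq0[w wws wz] _|pz0] := eqVneq (toC (linprod ws)).[z] 0.
  have w0 : 0 < w by apply: (allP ws0).
  exists w^-1; first by rewrite invr_gt0.
  have wC : w%:C != 0 by rewrite fmorph_eq0 gt_eqF.
  apply: (mulfI wC); rewrite fmorphV mulfV //.
  by apply/eqP; rewrite eq_sym -subr_eq0 wz.
have wz := linprodC_neq0 pz0.
rewrite deriv_linprodC // mulrCA -{1}[(toC _).[z]]mulr1 -mulrDr.
move=> /eqP; rewrite mulf_eq0 (negPf pz0) /= => /eqP.
set S := \sum_(_ <- _) _ => S0.
(* Here S = z p'(z) / p(z). *)
have {}S0 : c%:C + S = 0.
  have cC : c%:C != 0 by rewrite fmorph_eq0 gt_eqF.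
  by rewrite -[RHS](mulr0 c%:C) -S0 fmorphV mulrDr mulr1 mulrA mulfV // mul1r.
case: z pz0 wz @S S0 => x y pz0 wz S S0.
(* For y nonzero, the imaginary part of [S] is -y times a sum of positive terms. The sum is not
   empty, since otherwise c = 0. *)
have y0 : y = 0.
  have : complex.Im S = 0.
    by have := congr1 (@complex.Im R) S0; case: (S) => a b /=; rewrite add0r.
  rewrite /S Im_sum.
  under eq_bigr do rewrite Im_summand.
  rewrite -mulr_sumr => /eqP; rewrite mulf_eq0 oppr_eq0 => /orP[/eqP //|/eqP q0].
  apply/eqP/negPn/negP => yn0.
  have : all (fun w => 0 < w / ((1 - w * x) ^+ 2 + (w * y) ^+ 2)) ws.
    apply/allP => w /(allP ws0) w0; rewrite divr_gt0 // ltr_wpDl ?sqr_ge0 //.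
    by rewrite exprn_even_gt0 //= mulf_neq0 // gt_eqF.
  move: q0 @S S0; case: (ws) => [|w vs].
    by move=> _ /= + _; rewrite big_nil => -[/eqP]; rewrite addr0 gt_eqF.
  rewrite big_cons => q0 _ _ /= /andP[w0 vs0]; move: q0; apply/eqP.
  rewrite gt_eqF // ltr_pwDl // big_seq sumr_ge0 // => v /(allP vs0).
  exact: ltW.
subst y; exists x => //; rewrite ltNge; apply/negP => x0.
have : c + \sum_(w <- ws) - (w * x / (1 - w * x)) = 0.
  apply: complexI; rewrite [RHS]rmorph0; apply: etrans S0.
  rewrite rmorphD rmorph_sum /=; congr (_ + _).
  apply: eq_bigr => w _.
  by rewrite rmorphN rmorphM fmorphV rmorphB rmorph1 !rmorphM.
(* For x <= 0 all summands are nonnegative, so adding c > 0 cannot give 0. *)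
apply/eqP; rewrite gt_eqF // ltr_pwDl // big_seq sumr_ge0 // => w /(allP ws0) w0.
rewrite -mulNr divr_ge0 //; nra.
Qed.

(* This inequality and the next one are proved factor by factor: the right-hand
   differential expression satisfies D(pq) = p^2 D(q) + q^2 D(p), and it is w x,
   respectively w^2, at 1 - w x. *)
Lemma linprod_laguerre ws x M :
  0 <= x -> all (> 0) ws -> all (fun w => (1 - w * x) ^+ 2 <= M) ws ->
  x * (\sum_(w <- ws) w) * (linprod ws).[x] ^+ 2 <=
  M * ((x * (linprod ws)^`().[x]) ^+ 2 - (linprod ws).[x] *
    (x * (linprod ws)^`().[x] + x ^+ 2 * (linprod ws)^`()^`().[x])).
Proof.
move=> x0; elim: ws => /= [_ _|w ws IH /andP[w0 ws0] /andP[wM wsM]].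
  by rewrite /linprod !big_nil !derivC !hornerC; lra.
have := IH ws0 wsM; rewrite linprod_cons big_cons.
move: (linprod ws) (\sum_(v <- ws) v) => p s.
have -> : ((1 - w *: 'X) * p)^`() = - w *: p + (1 - w *: 'X) * p^`().
  by rewrite derivM derivB derivC derivZ derivX -!mul_polyC polyCN; ring.
have -> : (- w *: p + (1 - w *: 'X) * p^`())^`() =
    - (w *+ 2) *: p^`() + (1 - w *: 'X) * p^`()^`().
  rewrite derivD derivM derivB derivC !derivZ derivX -!mul_polyC !polyCN.
  by rewrite polyCMn; ring.
rewrite !(hornerD, hornerM, hornerZ, hornerN, hornerX, hornerC).
move: p.[x] p^`().[x] p^`()^`().[x] => P P1 P2 H.
(* The new factor adds w x P^2 to the differential expression; [M] compensates for the factor (1 - w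
   x)^2 on the left. *)
have H1 := ler_wpM2l (sqr_ge0 (1 - w * x)) H.
have H2 : x * w * ((1 - w * x) ^+ 2 * P ^+ 2) <= x * w * (M * P ^+ 2).
  rewrite ler_wpM2l ?mulr_ge0 ?ler_wpM2r ?sqr_ge0 //; exact: ltW.
have := lerD H1 H2; congr (_ <= _); ring.
Qed.

Lemma normsq_linprod ws x y : all (> 0) ws ->
  let p := linprod ws in
  0 <= p^`().[x] ^+ 2 - p.[x] * p^`()^`().[x] /\
  p.[x] ^+ 2 + y ^+ 2 * (p^`().[x] ^+ 2 - p.[x] * p^`()^`().[x]) <=
  complex.Re (toC p).[x +i* y] ^+ 2 + complex.Im (toC p).[x +i* y] ^+ 2.
Proof.
elim: ws => [_ /=|w ws IH /= /andP[w0 /IH{IH} /=]].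
  by rewrite /linprod !big_nil rmorph1 !derivC !hornerC /=; lra.
rewrite linprod_cons rmorphM /= map_linear_factor.
move: (linprod ws) => p.
have -> : ((1 - w *: 'X) * p)^`() = - w *: p + (1 - w *: 'X) * p^`().
  by rewrite derivM derivB derivC derivZ derivX -!mul_polyC polyCN; ring.
have -> : (- w *: p + (1 - w *: 'X) * p^`())^`() =
    - (w *+ 2) *: p^`() + (1 - w *: 'X) * p^`()^`().
  rewrite derivD derivM derivB derivC !derivZ derivX -!mul_polyC !polyCN.
  by rewrite polyCMn; ring.
rewrite !(hornerD, hornerM, hornerZ, hornerN, hornerX, hornerC).
move: p.[x] p^`().[x] p^`()^`().[x] ((toC p).[_]) => P P1 P2 [A B] /= [H1 H2].
rewrite (_ : _ ^+ 2 - _ = w ^+ 2 * P ^+ 2 + (1 - w * x) ^+ 2 * (P1 ^+ 2 - P * P2));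
  last by ring.
split; first by rewrite addr_ge0 // mulr_ge0 ?sqr_ge0.
(* The new factor has squared modulus (1 - w x)^2 + (w y)^2. When the product is expanded, the term
   in [H4] is the only one discarded. *)
have H3 := ler_wpM2l (addr_ge0 (sqr_ge0 (1 - w * x)) (sqr_ge0 (w * y))) H2.
have H4 : 0 <= (w * y) ^+ 2 * (y ^+ 2 * (P1 ^+ 2 - P * P2)).
  exact: mulr_ge0 (sqr_ge0 _) (mulr_ge0 (sqr_ge0 _) H1).
rewrite -subr_ge0; rewrite -subr_ge0 in H3.
have := addr_ge0 H4 H3; congr (_ <= _); ring.
Qed.

Lemma coef1_linprod ws : (linprod ws)`_1 = - \sum_(w <- ws) w.
Proof.
elim: ws => [|w ws IH]; first by rewrite /linprod !big_nil coefC oppr0.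
rewrite linprod_cons big_cons mulrBl mul1r -scalerAl coefB coefZ coefXM /= IH.
by rewrite -horner_coef0 horner_linprod0 mulr1 opprD addrC.
Qed.

Lemma coef_theta p n : ('X * p^`())`_n = n%:R * p`_n.
Proof.
by rewrite coefXM; case: n => [|n] /=; rewrite ?mul0r // coef_deriv mulr_natl.
Qed.

(** Since 0 < w <= s, where s is the sum of the w, the constant (1 + x s)^2 serves as [M]. Writing s
    as minus the linear coefficient removes the factorization from the inequality, which can then
    pass to the limit. *)
Lemma positive_rooted_laguerre p x : 0 <= x -> positive_rooted p ->
  x * (- p`_1) * p.[x] ^+ 2 <=
  (1 + x * (- p`_1)) ^+ 2 * (('X * p^`()).[x] ^+ 2 - p.[x] * ('X * ('X * p^`())^`()).[x]).
Proof.
move=> x0 [ws ws0 ->]; have := @linprod_laguerre ws x ((1 + x * \sum_(w <- ws) w) ^+ 2)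
  x0 ws0.
rewrite coef1_linprod opprK derivM derivX mul1r !(hornerD, hornerM, hornerX).
set q := linprod ws; have -> : x * (q^`().[x] + x * q^`()^`().[x]) =
  x * q^`().[x] + x ^+ 2 * q^`()^`().[x] by ring.
apply; apply/allP => w wws.
have w0 : 0 < w by apply: (allP ws0).
have ww : w <= \sum_(w <- ws) w.
  rewrite (big_rem w) //= lerDl big_seq sumr_ge0 // => v /mem_rem /(allP ws0).
  exact: ltW.
move: (\sum_(_ <- _) _) ww => s sw.
rewrite -subr_ge0 (_ : _ - _ = x * (s + w) * (2 + x * (s - w))); last by ring.
by rewrite !mulr_ge0 // addr_ge0 ?mulr_ge0 ?subr_ge0 ?(ltW w0) // (le_trans (ltW w0)).
Qed.

(** Multiplication by x^2 replaces p' and p'' by iterates of theta, through x^2 p'' = theta^2 p -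
    theta p. *)
Lemma positive_rooted_normsq p x y : positive_rooted p ->
  let q := (toC p).[x +i* y] in
  let n := complex.Re q ^+ 2 + complex.Im q ^+ 2 in
  p.[x] ^+ 2 <= n /\
  x ^+ 2 * p.[x] ^+ 2 + y ^+ 2 * (('X * p^`()).[x] ^+ 2 - p.[x] *
    (('X * ('X * p^`())^`()).[x] - ('X * p^`()).[x])) <= x ^+ 2 * n.
Proof.
move=> [ws ws0 ->] q n; have [H1 H2] := normsq_linprod x y ws0.
split; first by apply: le_trans H2; rewrite lerDl mulr_ge0 ?sqr_ge0.
have := ler_wpM2l (sqr_ge0 x) H2.
rewrite derivM derivX mul1r !(hornerD, hornerM, hornerX).
by congr (_ <= _); ring.
Qed.

End PositiveRoots.

(** * Dominated series *)

Section DominatedSeries.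
Variable R : realType.
Implicit Types (a A e v : nat -> R) (x r : R).

Lemma dominated_series a A :
  (forall n, `|a n| <= A n) -> cvgn (series A) -> cvgn (series a).
Proof.
move=> aA cA; apply: normed_cvg.
by apply: (series_le_cvg _ _ _ cA) => //= n; exact: le_trans (aA n).
Qed.

Lemma dominated_block a A K N : (forall n, `|a n| <= A n) -> (K <= N)%N ->
  `|series a N - series a K| <= series A N - series A K.
Proof.
move=> aA KN; rewrite !sub_series_geq //.
by rewrite (le_trans (ler_norm_sum _ _ _)) // ler_sum.
Qed.

Lemma dominated_tail a A K : (forall n, `|a n| <= A n) -> cvgn (series A) ->
  `|limn (series a) - series a K| <= limn (series A) - series A K.
Proof.
move=> aA cA; have ca := dominated_series aA cA.
have h : `|series a N - series a K| @[N --> \oo] --> `|limn (series a) - series a K|.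
  by apply: cvg_norm; apply: cvgB => //; exact: cvg_cst.
have h' : series A N - series A K @[N --> \oo] --> limn (series A) - series A K.
  by apply: cvgB => //; exact: cvg_cst.
apply: (ler_cvg_to h h'); near=> N; apply: dominated_block => //.
by near: N; exact: nbhs_infty_ge.
Unshelve. all: by end_near. Qed.

(** Tannery's theorem; the truncation [h N] varies with [N] to suit polynomials of growing
    degree. *)
Lemma tannery (u : nat -> nat -> R) v A (h : nat -> nat) :
  (forall N n, `|u N n| <= A n) -> cvgn (series A) ->
  (forall n, u N n @[N --> \oo] --> v n) -> (forall N, (N <= h N)%N) ->
  series (u N) (h N) @[N --> \oo] --> limn (series v).
Proof.
move=> uA cA uv hN.
have vA n : `|v n| <= A n.
  by apply: (cvgr_to_le (cvg_norm (uv n))); near=> N; exact: uA.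
apply/cvgrPdist_le => e e0.
have e3 : 0 < e / 3 by rewrite divr_gt0.
(* Beyond [K] the tail of [A] bounds both the tail of [v] and the block of [u N] up to [h N]; before
   [K] there are finitely many terms. *)
have [K _ AK] : \forall K \near \oo, `|limn (series A) - series A K| <= e / 3.
  by move/cvgrPdist_le : cA; apply.
have {}AK := AK K (leqnn K).
have uK : series (u N) K @[N --> \oo] --> series v K.
  by apply: cvg_big => [|i _]; [exact: add_continuous|exact: uv].
near=> N.
have KN : (K <= h N)%N by apply: leq_trans (hN N); near: N; exact: nbhs_infty_ge.
have H1 := dominated_tail K vA cA.
have H2 := dominated_block (uA N) KN.
have H3 : `|series v K - series (u N) K| <= e / 3.
  by near: N; move/cvgrPdist_le : uK; apply.
have H4 : series A (h N) <= limn (series A).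
  apply: nondecreasing_cvgn_le cA (h N).
  apply: nondecreasing_series => n _ _; exact: le_trans (vA n).
move: AK H1 H2 H3 H4; rewrite !ler_norml.
move: (limn (series v)) (limn (series A)) => *; lra.
Unshelve. all: by end_near. Qed.

End DominatedSeries.

(** * Entire power series *)

Section EntireSeries.
Variable R : realType.
Implicit Types (a b A : nat -> R) (x y r : R) (z h : R[i]).

Definition entire a := forall x : R, cvgn (pseries a x).

Definition psum a x : R := limn (pseries a x).

Definition theta a n := n%:R * a n.

(** Convergence at a point of larger modulus gives absolute convergence. *)
Lemma entire_norm a : entire a -> forall x, cvgn (pseries (fun n => `|a n|) x).
Proof.
move=> ea x; move: ea => /(_ (`|x| + 1)) /is_cvg_pseries_inside_norm; apply.
by rewrite (ger0_norm (_ : 0 <= _ + 1)) ?ltrDl // addr_ge0.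
Qed.

Lemma entire_dominated a b c r : entire a ->
  (forall n, `|b n| <= c * (`|a n| * r ^+ n)) -> cvgn (series b).
Proof.
move=> ea ba; apply: (dominated_series ba).
rewrite (_ : series _ = fun n => c * pseries (fun n => `|a n|) r n).
  by apply: is_cvgM; [exact: is_cvg_cst|exact: entire_norm].
by apply/funext => n; rewrite /pseries /series /= mulr_sumr.
Qed.

Lemma entire_growth a b r : entire a -> (forall n, `|b n| <= `|a n| * r ^+ n) ->
  entire b.
Proof.
move=> ea ba x; apply: (@entire_dominated a _ 1 (r * `|x|) ea) => n.
by rewrite mul1r exprMn mulrA normrM normrX ler_wpM2r.
Qed.

Lemma natr_le_exp2 n : n%:R <= 2 ^+ n :> R.
Proof. by rewrite -natrX ler_nat ltnW // ltn_expl. Qed.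

Lemma entire_theta a : entire a -> entire (theta a).
Proof.
move=> ea; apply: (entire_growth (r := 2) ea) => n.
by rewrite normrM mulrC normr_nat ler_wpM2l // natr_le_exp2.
Qed.

Lemma theta_pseries n a x : theta a n * x ^+ n = x * (n%:R * a n * x ^+ n.-1).
Proof.
by case: n => [|n]; rewrite /theta ?mul0r ?mulr0 // exprS mulrCA.
Qed.

Lemma is_cvg_series_shift b : cvgn (series b) -> cvgn (series (fun n => b n.+1)).
Proof.
move=> cb; have -> : series (fun n => b n.+1) = (fun n => series b n.+1 - b 0%N).
  by apply/funext => n; rewrite /series /= big_nat_recl // addrC addKr.
by apply: is_cvgB; [apply/cvg_ex; exists (limn (series b));
  rewrite cvg_shiftS|exact: is_cvg_cst].
Qed.

Lemma entire_diffs a : entire a -> entire (pseries_diffs a).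
Proof.
(* The 2 absorbs the factor n+1 <= 2^(n+1), and |x| + 1 >= 1 absorbs the shift of the exponent. *)
move=> ea x; pose r : R := 2 * (`|x| + 1).
have := is_cvg_series_shift (@entire_norm _ ea r); apply: dominated_series => n.
rewrite /pseries_diffs /= !normrM normr_nat normrX -mulrA mulrCA ler_wpM2l //.
rewrite exprMn ler_pM ?natr_le_exp2 ?exprn_ge0 //.
apply: (@le_trans _ _ ((`|x| + 1) ^+ n)).
  by rewrite lerXn2r ?nnegrE ?addr_ge0 // lerDl.
by rewrite exprS ler_peMl ?exprn_ge0 ?addr_ge0 // lerDr.
Qed.

Lemma is_derive_psum a x : entire a ->
  is_derive x 1 (psum a) (psum (pseries_diffs a) x).
Proof.
move=> ea; apply: (@pseries_snd_diffs _ _ (`|x| + 1)).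
- exact: ea.
- exact: entire_diffs.
- exact/entire_diffs/entire_diffs.
- by rewrite (ger0_norm (_ : 0 <= _ + 1)) ?ltrDl // addr_ge0.
Qed.

Lemma psum_theta a x : entire a -> psum (theta a) x = x * psum (pseries_diffs a) x.
Proof.
move=> ea; have := pseries_diffs_equiv (@entire_diffs _ ea x) => c.
apply: cvg_lim => //.
rewrite (_ : pseries _ _ = (fun n => x * [series n%:R * a n * x ^+ n.-1]_n n)).
  exact: cvgMl_tmp c.
by apply/funext => n; rewrite /pseries /series /= mulr_sumr;
  under eq_bigr do rewrite theta_pseries.
Qed.

Lemma psum0 a : psum a 0 = a 0%N.
Proof.
apply: cvg_lim => //; rewrite -cvg_shiftS.
rewrite (_ : (fun _ => _) = cst (a 0%N)); first exact: cvg_cst.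
apply/funext => n; rewrite /pseries /series /= big_nat_recl // expr0 mulr1 big1 ?addr0 //
  => i _.
by rewrite expr0n mulr0.
Qed.

End EntireSeries.

(** * Power series with real coefficients at complex points *)

Section ComplexSeries.
Variable R : realType.
Implicit Types (a b : nat -> R) (x y r : R) (z h l : R[i]) (u : nat -> R[i]).
Local Notation normc := (@complex.ComplexField.Normc.normc R).

Lemma normrcE z : `|z| = (normc z)%:C.
Proof. by case: z. Qed.

Lemma normc_ge0 z : 0 <= normc z.
Proof. by case: z => x y; exact: sqrtr_ge0. Qed.

Lemma normc_leD x y : normc (x +i* y) <= `|x| + `|y|.
Proof.
rewrite /= -[leRHS]ger0_norm ?addr_ge0 // -sqrtr_sqr ler_wsqrtr //.
by rewrite sqrrD !real_normK ?num_real // addrAC lerDl mulrn_wge0 // mulr_ge0.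
Qed.

Lemma Re_le_normc z : `|complex.Re z| <= normc z.
Proof. by case: z => x y /=; rewrite -sqrtr_sqr ler_wsqrtr // lerDl sqr_ge0. Qed.

Lemma Im_le_normc z : `|complex.Im z| <= normc z.
Proof. by case: z => x y /=; rewrite -sqrtr_sqr ler_wsqrtr // lerDr sqr_ge0. Qed.

Lemma normcX z n : normc (z ^+ n) = normc z ^+ n.
Proof.
by apply: complexI; rewrite -normrcE normrX normrcE rmorphXn.
Qed.

Lemma cvg_complex (f g : nat -> R) x y : f n @[n --> \oo] --> x -> g n @[n --> \oo] --> y ->
  (f n +i* g n : R[i]^o) @[n --> \oo] --> (x +i* y : R[i]^o).
Proof.
move=> fx gy; apply/cvgrPdist_le => -[e1 e2] /=.
(* A positive element of [R[i]] is real, so the tolerance is a real number. *)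
rewrite ltcE /= => /andP[/eqP -> e0].
have e20 : 0 < e1 / 2 by rewrite divr_gt0.
near=> n; rewrite normrcE -[e1 +i* 0]/(e1%:C) lecR; apply: le_trans (normc_leD _ _) _.
rewrite (splitr e1) lerD //.
  by near: n; move/cvgrPdist_le : fx; apply.
by near: n; move/cvgrPdist_le : gy; apply.
Unshelve. all: by end_near. Qed.

Lemma cvg_complex_series u :
  cvgn (series (fun n => complex.Re (u n))) -> cvgn (series (fun n => complex.Im (u n))) ->
  series (u : nat -> R[i]^o) n @[n --> \oo] -->
   (limn (series (fun n => complex.Re (u n))) +i* limn (series (fun n => complex.Im (u
     n))) : R[i]^o).
Proof.
move=> cr ci; have := cvg_complex cr ci; apply: cvg_trans; apply: near_eq_cvg.
apply: nearW => n /=; rewrite /series /= -Re_sum -Im_sum.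
by case: (\sum_(0 <= i < n) u i).
Qed.

Definition cpsum a z : R[i]^o := limn (series (fun n => (a n)%:C * z ^+ n : R[i]^o)).

Definition resum a z : R := limn (series (fun n => a n * complex.Re (z ^+ n))).
Definition imsum a z : R := limn (series (fun n => a n * complex.Im (z ^+ n))).

Lemma ReZ x z : complex.Re (x%:C * z) = x * complex.Re z.
Proof. by case: z => p q /=; rewrite mul0r subr0. Qed.

Lemma ImZ x z : complex.Im (x%:C * z) = x * complex.Im z.
Proof. by case: z => p q /=; rewrite mul0r addr0. Qed.

(** The real and imaginary parts are bounded separately; the resulting factor 2 is harmless. *)
Lemma complex_dominated u (A : nat -> R) : (forall n, normc (u n) <= A n) ->
  cvgn (series A) ->
  [/\ cvgn (series (fun n => complex.Re (u n))), cvgn (series (fun n => complex.Im (u n))) &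
  normc (limn (series (u : nat -> R[i]^o))) <= limn (series A) + limn (series A)].
Proof.
move=> uA cA.
have rA n : `|complex.Re (u n)| <= A n := le_trans (Re_le_normc _) (uA n).
have iA n : `|complex.Im (u n)| <= A n := le_trans (Im_le_normc _) (uA n).
have [cr ci] := (dominated_series rA cA, dominated_series iA cA).
split => //.
have -> := cvg_lim _ (cvg_complex_series cr ci); last exact: norm_hausdorff.
apply: le_trans (normc_leD _ _) _; apply: lerD.
  have := dominated_tail 0 rA cA; rewrite /series /= !big_geq // !subr0. exact.
have := dominated_tail 0 iA cA; rewrite /series /= !big_geq // !subr0. exact.
Qed.

Lemma cpsum_cvg a z : entire a ->
  series (fun n => (a n)%:C * z ^+ n : R[i]^o) n @[n --> \oo] --> cpsum a z
  /\ cpsum a z = resum a z +i* imsum a z.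
Proof.
move=> ea; have cA := @entire_norm _ _ ea (normc z).
have [n|cr ci _] := complex_dominated (u := fun n => (a n)%:C * z ^+ n) _ cA.
  by rewrite -lecR -normrcE normrM !normrcE normcX /= expr0n addr0 sqrtr_sqr rmorphM.
have H := cvg_complex_series cr ci.
have E : cpsum a z = resum a z +i* imsum a z.
  rewrite /cpsum (cvg_lim _ H); last exact: norm_hausdorff.
  rewrite /resum /imsum.
  under [X in series X]eq_fun do rewrite ReZ.
  by under [X in _ +i* limn (series X)]eq_fun do rewrite ImZ.
split; last exact: E.
by rewrite /cpsum (cvg_lim _ H); [exact: H|exact: norm_hausdorff].
Qed.

End ComplexSeries.

(** * Complex differentiability of entire series *)

Section ComplexDerivative.
Variable R : realType.
Implicit Types (a b : nat -> R) (x y r : R) (z h l : R[i]) (u : nat -> R[i]).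
Import complex.ComplexField.Normc.

Lemma cpsum_real a x : entire a -> cpsum a x%:C = (psum a x)%:C.
Proof.
move=> ea; have [_ ->] := cpsum_cvg x%:C ea; rewrite /resum /imsum.
have -> : (fun n => a n * complex.Re (x%:C ^+ n)) = (fun n => a n * x ^+ n).
  by apply/funext => n; rewrite -rmorphXn.
have -> : (fun n => a n * complex.Im (x%:C ^+ n)) = (fun=> 0).
  by apply/funext => n; rewrite -rmorphXn /= mulr0.
have -> : series (fun=> 0 : R) = cst 0.
  by apply/funext => n; rewrite /series /= big1.
by rewrite (cvg_lim _ (cvg_cst _)).
Qed.

Lemma normc_real x : normc x%:C = `|x|.
Proof. by rewrite /= expr0n addr0 sqrtr_sqr. Qed.

Lemma normc_natr n : normc (n%:R : R[i]) = n%:R.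
Proof. by apply: complexI; rewrite -normrcE normr_nat rmorph_nat. Qed.

(** The remainder of order two grows only geometrically in n, so it can be summed against the
    coefficients of an entire series. *)
Lemma exprD_remainder z h r n : 1 <= r -> normc z <= r -> normc (z + h) <= r ->
  normc ((z + h) ^+ n - z ^+ n - h * (n%:R * z ^+ n.-1)) <=
  normc h ^+ 2 * (4 * r) ^+ n.
Proof.
move=> r1 zr zhr; have r0 : 0 <= r := le_trans ler01 r1.
elim: n => [|n IH].
  by rewrite !expr0 mul0r mulr0 subrr subr0 normc0 mulr1 sqr_ge0.
have -> : (z + h) ^+ n.+1 - z ^+ n.+1 - h * (n.+1%:R * z ^+ n.+1.-1) =
  (z + h) * ((z + h) ^+ n - z ^+ n - h * (n%:R * z ^+ n.-1)) + h ^+ 2 * (n%:R * z ^+ n.-1).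
  by case: n {IH} => [|n]; rewrite ?expr0 ?expr1 /= -?[n.+2%:R]natr1 -?[n.+1%:R]natr1
    ?exprS; ring.
apply: le_trans (le_normcD _ _) _; rewrite normcM [normc (h ^+ 2 * _)]normcM normcX
  [normc (n%:R * _)]normcM normc_natr normcX.
have H1 : normc (z + h) * normc ((z + h) ^+ n - z ^+ n - h * (n%:R * z ^+ n.-1)) <=
   r * (normc h ^+ 2 * (4 * r) ^+ n) by rewrite ler_pM // normc_ge0.
have H2 : n%:R * normc z ^+ n.-1 <= 4 ^+ n * r ^+ n.
  rewrite ler_pM ?exprn_ge0 ?normc_ge0 //.
    apply: le_trans (natr_le_exp2 _ n) _; rewrite lerXn2r ?nnegrE //; lra.
  apply: (@le_trans _ _ (r ^+ n.-1)); first by rewrite lerXn2r ?nnegrE ?normc_ge0.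
  by rewrite ler_weXn2l // leq_pred.
have H3 := ler_wpM2l (sqr_ge0 (normc h)) H2.
apply: le_trans (lerD H1 H3) _; rewrite -exprMn [_ ^+ n.+1]exprS.
have T0 : 0 <= normc h ^+ 2 * (4 * r) ^+ n by rewrite mulr_ge0 ?sqr_ge0 ?exprn_ge0
  ?mulr_ge0.
(* What remains is r t + t <= 4 r t, which follows from r >= 1. *)
by rewrite [leRHS]mulrCA; move: (_ * _ ^+ n) T0 => t t0; nra.
Qed.

Lemma cpsum_diffs_cvg a z : entire a ->
  series (fun n => (a n)%:C * (n%:R * z ^+ n.-1) : R[i]^o) n @[n --> \oo] -->
  cpsum (pseries_diffs a) z.
Proof.
(* The term at n = 0 vanishes, which reconciles the two indexings. *)
move=> ea; rewrite -cvg_shiftS.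
rewrite (_ : (fun _ => _) = series (fun n => (pseries_diffs a n)%:C * z ^+ n : R[i]^o)).
  by case: (cpsum_cvg z (entire_diffs ea)).
apply/funext => n; rewrite /series /= big_nat_recl // mul0r mulr0 add0r.
apply: eq_bigr => i _ /=; rewrite /pseries_diffs rmorphM rmorph_nat /=.
by rewrite mulrA [_ * _%:R]mulrC.
Qed.

Lemma cvg_affine_comb (K : numFieldType) (u v w : nat -> K^o) (x y t h : K^o) :
  u n @[n --> \oo] --> x -> v n @[n --> \oo] --> y -> w n @[n --> \oo] --> t ->
  u n - v n - h * w n @[n --> \oo] --> x - y - h * t.
Proof.
move=> ux vy wt; apply: cvgB; first exact: cvgB.
by apply: cvgM; [exact: cvg_cst|].
Qed.

Lemma cpsum_taylor a z : entire a -> exists2 c, 0 <= c & forall h, normc h <= 1 ->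
  normc (cpsum a (z + h) - cpsum a z - h * cpsum (pseries_diffs a) z) <= c * normc h ^+ 2.
Proof.
(* For |h| <= 1 both z and z + h have modulus at most |z| + 1, and [exprD_remainder] multiplies this
   radius by 4. *)
move=> ea; pose r : R := 4 * (normc z + 1).
pose S := limn (pseries (fun n => `|a n|) r).
have S0 : 0 <= S.
  apply: (cvgr_to_ge (@entire_norm _ _ ea r)); apply: nearW => n.
  by apply: sumr_ge0 => i _; rewrite mulr_ge0 ?exprn_ge0 ?mulr_ge0 ?addr_ge0 ?normc_ge0.
exists (S + S) => [|h h1]; first exact: addr_ge0.
pose u n := (a n)%:C * ((z + h) ^+ n - z ^+ n - h * (n%:R * z ^+ n.-1)).
have uA n : normc (u n) <= normc h ^+ 2 * (`|a n| * r ^+ n).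
  rewrite /u normcM normc_real [leRHS]mulrCA ler_wpM2l //.
  apply: exprD_remainder; rewrite ?lerDr ?lerDl ?normc_ge0 //.
  by apply: le_trans (le_normcD _ _) _; rewrite lerD2l.
have cA : series (fun n => normc h ^+ 2 * (`|a n| * r ^+ n)) n @[n --> \oo] --> normc h
  ^+ 2 * S.
  rewrite (_ : series _ = fun n => normc h ^+ 2 * pseries (fun n => `|a n|) r n).
    by apply: cvgM; [exact: cvg_cst|exact: (@entire_norm _ _ ea r)].
  by apply/funext => n; rewrite /pseries /series /= mulr_sumr.
have [_ _] := complex_dominated uA (cvgP _ cA).
rewrite (cvg_lim _ cA) // (_ : limn _ = cpsum a (z + h) - cpsum a z - h * cpsum
  (pseries_diffs a) z).
  by rewrite -mulrDr [_ * (S + S)]mulrC.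
apply: cvg_lim; first exact: norm_hausdorff.
rewrite (_ : series _ = fun n => series (fun n => (a n)%:C * (z + h) ^+ n : R[i]^o) n
  - series (fun n => (a n)%:C * z ^+ n : R[i]^o) n
  - h * series (fun n => (a n)%:C * (n%:R * z ^+ n.-1) : R[i]^o) n); last first.
  apply/funext => n; rewrite /series /= mulr_sumr -!sumrB; apply: eq_bigr => i _.
  by rewrite /u; ring.
have [c1 _] := cpsum_cvg (z + h) ea; have [c2 _] := cpsum_cvg z ea.
exact: (cvg_affine_comb c1 c2 (cpsum_diffs_cvg ea)).
Qed.

Lemma is_derive_quadratic (K : numFieldType) (f : K^o -> K^o) (z l c : K) :
  0 <= c -> (forall h : K, `|h| <= 1 -> `|f (z + h) - f z - h * l| <= c * `|h| ^+ 2) ->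
  is_derive (z : K^o) 1 f l.
Proof.
move=> c0 H.
have L : h^-1 *: ((f \o shift z) (h *: 1) - f z) @[h --> 0^'] --> (l : K^o).
  apply/cvgrPdist_le => e e0; near=> h.
  have h0 : h != 0 by near: h; exact: nbhs_dnbhs_neq.
  have h1 : `|h| <= 1 by near: h; exact: dnbhs0_le.
  (* The 1 is added because c may be 0. *)
  have hc : `|h| <= e / (c + 1).
    by near: h; apply: dnbhs0_le; rewrite divr_gt0 // ltr_wpDl.
  rewrite distrC /GRing.scale /= mulr1 [h + z]addrC.
  rewrite (_ : _ - l = h^-1 * (f (z + h) - f z - h * l)); last first.
    by rewrite [RHS]mulrBr mulKf.
  rewrite normrM normfV ler_pdivrMl ?normr_gt0 //; apply: le_trans (H _ h1) _.
  rewrite expr2 mulrCA ler_wpM2l //.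
  apply: le_trans (ler_wpM2l c0 hc) _.
  rewrite mulrCA ler_piMr ?(ltW e0) // ler_pdivrMr ?mul1r ?lerDl //.
  by rewrite ltr_wpDl.
have D : derivable f z 1 by apply/cvg_ex; exists l; exact: L.
apply: DeriveDef => //; rewrite /derive.
by apply: cvg_lim L; exact: norm_hausdorff.
Unshelve. all: by end_near. Qed.

Lemma is_derive_cpsum a z : entire a ->
  is_derive (z : R[i]^o) 1 (cpsum a) (cpsum (pseries_diffs a) z).
Proof.
move=> ea; have [c c0 H] := cpsum_taylor z ea.
apply: (@is_derive_quadratic _ _ _ _ c%:C); first by rewrite ler0c.
move=> h; rewrite !normrcE -[1]/(1%:C) lecR => /H; rewrite -lecR rmorphM rmorphXn.
exact.
Qed.

End ComplexDerivative.

(** * The coefficients and their polynomial approximations *)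

Section Coefficients.
Variable R : realType.
Implicit Types (b x : R) (n m : nat).

Lemma pochhammerSr b n : pochhammer b n.+1 = pochhammer b n * (b + n%:R).
Proof. exact: big_ord_recr. Qed.

Lemma pochhammerSl b n : pochhammer b n.+1 = b * pochhammer (b + 1) n.
Proof.
rewrite /pochhammer big_ord_recl addr0; congr (_ * _); apply: eq_bigr => i _.
by rewrite lift0 -natr1 [_ + 1]addrC addrA.
Qed.

Lemma pochhammerD b n m : pochhammer b (n + m) = pochhammer b n * pochhammer (b + n%:R) m.
Proof.
rewrite /pochhammer big_split_ord /=; congr (_ * _); apply: eq_bigr => i _.
by rewrite natrD addrA.
Qed.

Lemma pochhammer_gt0 b n : 0 < b -> 0 < pochhammer b n.
Proof. by move=> b0; apply: prodr_gt0 => i _; rewrite ltr_wpDr. Qed.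

Lemma pochhammer_ge b n : 0 < b -> b ^+ n <= pochhammer b n.
Proof.
move=> b0; rewrite -[n in b ^+ n]card_ord -prodr_const; apply: ler_prod => i _.
by rewrite ltW //= lerDl.
Qed.

(** Multiplied by (b)_m (b)_n, both sides become (b)_(m+n), split in its two ways. The product is
    the effect on the n-th coefficient of [polar] taken at b, b+1, ..., b+m-1. *)
Lemma prod_1Ddiv b n m : 0 < b ->
  \prod_(k < m) (1 + n%:R / (b + k%:R)) = pochhammer (b + m%:R) n / pochhammer b n.
Proof.
move=> b0; have p0 k := lt0r_neq0 (pochhammer_gt0 k b0).
apply: (mulIf (p0 n)); rewrite mulfVK //.
apply: (mulfI (p0 m)); rewrite -pochhammerD addnC pochhammerD mulrCA mulrA mulrC.
congr (_ * _); rewrite /pochhammer -big_split /=; apply: eq_bigr => k _.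
have bk : b + k%:R != 0 by rewrite gt_eqF // ltr_wpDr.
by field.
Qed.

(** * Hyper-Bessel coefficients and the polynomials converging to the series *)

Section HyperBesselCoef.
Variables (d : nat) (alpha : 'I_d -> R).
Hypothesis alpha_gtN1 : forall i, -1 < alpha i.
Local Notation a := (hyperBessel_coef alpha).

Let alpha1_gt0 i : 0 < alpha i + 1.
Proof. by rewrite -ltrBlDr sub0r. Qed.

Let prod_gt0 n : 0 < \prod_(i < d) pochhammer (alpha i + 1) n.
Proof. by apply: prodr_gt0 => i _; exact: pochhammer_gt0. Qed.

Lemma hyperBessel_coef0 : a 0%N = 1.
Proof.
rewrite /hyperBessel_coef fact0 expr0 mul1r big1 ?mulr1 ?invr1 // => i _.
by rewrite /pochhammer big_ord0.
Qed.

Lemma hyperBessel_coef1 : a 1%N = - (\prod_(i < d) (alpha i + 1))^-1.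
Proof.
rewrite /hyperBessel_coef expr1 mul1r mulN1r; congr (- _^-1); apply: eq_bigr => i _.
by rewrite /pochhammer big_ord1 addr0.
Qed.

Lemma normr_hyperBessel_coef n :
  `|a n| = (n`!%:R * \prod_(i < d) pochhammer (alpha i + 1) n)^-1.
Proof.
by rewrite normrM normrX normrN1 expr1n mul1r ger0_norm // invr_ge0 mulr_ge0 // ltW.
Qed.

(** As (b)_n >= b^n, the terms are dominated by those of exp(|x| / q). *)
Lemma entire_hyperBessel : entire a.
Proof.
pose q := \prod_(i < d) (alpha i + 1).
have q0 : 0 < q by apply: prodr_gt0.
move=> x; apply: dominated_series (is_cvg_series_exp_coeff (`|x| / q)) => n.
rewrite normrM normrX normr_hyperBessel_coef /exp_coeff /= exprMn invfM mulrC -mulrA.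
rewrite ler_wpM2l ?exprn_ge0 // mulrC ler_wpM2r ?invr_ge0 // exprVn lef_pV2 ?posrE
  ?exprn_gt0 //.
rewrite -prodrXl; apply: ler_prod => i _.
by apply/andP; split; [exact/exprn_ge0/ltW | exact: pochhammer_ge].
Qed.

Lemma hyperBessel_coef_diffs n : pseries_diffs a n =
  - (\prod_(i < d) (alpha i + 1))^-1 * hyperBessel_coef (fun i => alpha i + 1) n.
Proof.
rewrite /pseries_diffs /hyperBessel_coef factS natrM exprS.
under eq_bigr do rewrite pochhammerSl.
rewrite big_split /= !invfM !mulN1r !mulNr !mulrN; congr (- _).
set q := (\prod_(i < d) (alpha i + 1))^-1; set p := (\prod_(i < d) _)^-1.
have n0 : n.+1%:R != 0 :> R by rewrite pnatr_eq0.
have f0 : n`!%:R != 0 :> R by rewrite pnatr_eq0 -lt0n fact_gt0.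
by rewrite mulrCA -!mulrA mulVKf //; field.
Qed.

(** A contiguity relation, which comes from (c)_n (c + n) = c (c+1)_n with c = alpha_i0 + 1. *)
Lemma hyperBessel_coef_bump i0 n :
  (n%:R + (alpha i0 + 1)) * hyperBessel_coef (fun i => alpha i + (i == i0)%:R) n =
  (alpha i0 + 1) * a n.
Proof.
rewrite /hyperBessel_coef !(bigD1 (P := xpredT) i0) //= eqxx.
under eq_bigr => i /negPf -> do rewrite addr0.
set p := \prod_(i < d | _) _.
have p0 : p != 0 by rewrite gt_eqF // prodr_gt0 // => i _; exact: pochhammer_gt0.
have f0 : n`!%:R != 0 :> R by rewrite pnatr_eq0 -lt0n fact_gt0.
have := pochhammerSl (alpha i0 + 1) n; rewrite pochhammerSr.
have := lt0r_neq0 (pochhammer_gt0 n (alpha1_gt0 i0)).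
have := pochhammer_gt0 n (addr_gt0 (alpha1_gt0 i0) ltr01) => /lt0r_neq0.
have := lt0r_neq0 (alpha1_gt0 i0); move: (alpha i0 + 1) => c.
move: (pochhammer c n) (pochhammer (c + 1) n) => x y c0 y0 x0 e.
have -> : n%:R + c = c * y / x by rewrite -e mulrC mulKf // addrC.
by field; rewrite x0 y0 p0 f0.
Qed.

(** The n-th coefficient of the power of degree M and each of the d products over k grow like M^n,
    which the scale M^(d+1) of the variable balances. *)
Definition approximant N : {poly R} :=
  let M := N.+1 in
  foldr (@polar R) ((1 - (M%:R ^+ d.+1)^-1 *: 'X) ^+ M)
    [seq alpha i + 1 + k%:R | i <- enum 'I_d, k <- iota 0 M].

Lemma approximant_positive_rooted N : positive_rooted (approximant N).
Proof.
rewrite /approximant; set cs := (X in foldr _ _ X).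
have : all (> 0) cs.
  by apply/allP => _ /allpairsP[[i k] /= [_ _ ->]]; rewrite ltr_wpDr.
elim: cs => [_|c cs IH /= /andP[c0 /IH]]; last exact: polar_positive_rooted.
exists (nseq N.+1 (N.+1%:R ^+ d.+1)^-1).
  by apply/allP => w /nseqP[-> _]; rewrite invr_gt0 exprn_gt0.
by rewrite /linprod big_nseq iter_mulr_1.
Qed.

(** The quotients multiplying [a n] each tend to 1 and are bounded geometrically in n, which gives
    both the limit and the domination. *)
Lemma coef_approximant N n : (approximant N)`_n =
  a n * ((N.+1 ^_ n)%:R / N.+1%:R ^+ n *
         \prod_(i < d) (pochhammer (alpha i + 1 + N.+1%:R) n / N.+1%:R ^+ n)).
Proof.
rewrite /approximant; set cs := (X in foldr _ _ X).
have coef_foldr p : (foldr (@polar R) p cs)`_n = \prod_(c <- cs) (1 + n%:R / c) * p`_n.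
  elim: cs => [|c cs IH] /=; first by rewrite big_nil mul1r.
  by rewrite coef_polar IH big_cons mulrA.
rewrite {}coef_foldr big_allpairs_dep big_enum -[iota 0 N.+1]/(index_iota 0 N.+1) /=.
under eq_bigr => i _ do rewrite big_mkord prod_1Ddiv //.
have -> t : ((1 - t *: 'X) ^+ N.+1 : {poly R})`_n = (- t) ^+ n * 'C(N.+1, n)%:R.
  have -> : (1 - t *: 'X) ^+ N.+1 = \poly_(i < N.+2) ((- t) ^+ i *+ 'C(N.+1, i)).
    rewrite poly_def exprDn; apply: eq_bigr => i _.
    by rewrite expr1n mul1r -scaleNr exprZn scalerMnl.
  rewrite coef_poly mulr_natr; case: ltnP => // Nn.
  by rewrite bin_small.
have f0 : n`!%:R != 0 :> R by rewrite pnatr_eq0 -lt0n fact_gt0.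
have -> : 'C(N.+1, n)%:R = (N.+1 ^_ n)%:R / n`!%:R :> R.
  by rewrite -bin_ffact natrM mulfK.
rewrite /hyperBessel_coef !big_split /= !prodfV prodr_const card_ord.
have -> : (- (N.+1%:R ^+ d.+1)^-1) ^+ n = (-1) ^+ n / (N.+1%:R ^+ n * (N.+1%:R ^+ n) ^+
  d) :> R.
  by rewrite [LHS]exprNn exprVn -exprS -!exprM mulnC.
have M0 : N.+1%:R ^+ n != 0 :> R by rewrite expf_neq0.
have := lt0r_neq0 (prod_gt0 n); move: (\prod_(i < d) pochhammer (alpha i + 1) n) => p p0.
have := expf_neq0 d M0; move: (_ ^+ n ^+ d) => Md Md0.
move: (N.+1%:R ^+ n) M0 (\prod_(i < d) _) => M M0 q; move: ((N.+1 ^_ n)%:R) => f.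
by field; rewrite p0 f0 Md0 M0.
Qed.

Lemma cvg_ffact_quotient n : (N.+1 ^_ n)%:R / N.+1%:R ^+ n @[N --> \oo] --> (1 : R).
Proof.
under eq_fun do rewrite ffact_prod natr_prod -[n in _ ^+ n]card_ord -prodr_const -prodf_div.
suff : \prod_(i < n) ((N.+1 - i)%:R / N.+1%:R) @[N --> \oo] --> \prod_(i < n) (1 : R).
  by rewrite big1.
apply: cvg_big => [|i _]; first exact: mul_continuous.
have h : 1 - i%:R * harmonic N @[N --> \oo] --> (1 - i%:R * 0 : R).
  by apply: cvgB; [exact: cvg_cst|apply: cvgM; [exact: cvg_cst|exact: cvg_harmonic]].
rewrite mulr0 subr0 in h; apply: cvg_trans h; apply: near_eq_cvg.
near=> N; rewrite /harmonic /= natrB; last by apply: leqW; near: N; exact: nbhs_infty_ge.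
by rewrite mulrBl mulfV.
Unshelve. all: by end_near. Qed.

Lemma cvg_pochhammer_quotient b n :
  pochhammer (b + N.+1%:R) n / N.+1%:R ^+ n @[N --> \oo] --> (1 : R).
Proof.
under eq_fun do rewrite /pochhammer -[n in _ ^+ n]card_ord -prodr_const -prodf_div.
suff : \prod_(i < n) ((b + N.+1%:R + i%:R) / N.+1%:R) @[N --> \oo] --> \prod_(i < n) (1 :
  R).
  by rewrite big1.
apply: cvg_big => [|i _]; first exact: mul_continuous.
have h : 1 + (b + i%:R) * harmonic N @[N --> \oo] --> (1 + (b + i%:R) * 0 : R).
  by apply: cvgD; [exact: cvg_cst|apply: cvgM; [exact: cvg_cst|exact: cvg_harmonic]].
rewrite mulr0 addr0 in h; apply: cvg_trans h; apply: near_eq_cvg.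
by apply: nearW => N; rewrite /harmonic /= [b + _ + _]addrAC [_ + N.+1%:R]addrC
  [RHS]mulrDl mulfV.
Qed.

Lemma cvg_coef_approximant n : (approximant N)`_n @[N --> \oo] --> a n.
Proof.
under eq_fun do rewrite coef_approximant.
have h : \prod_(i < d) (pochhammer (alpha i + 1 + N.+1%:R) n / N.+1%:R ^+ n) @[N --> \oo]
  -->
    \prod_(i < d) (1 : R).
  apply: cvg_big => [|i _]; [exact: mul_continuous|exact: cvg_pochhammer_quotient].
suff : a n * ((N.+1 ^_ n)%:R / N.+1%:R ^+ n *
    \prod_(i < d) (pochhammer (alpha i + 1 + N.+1%:R) n / N.+1%:R ^+ n))
    @[N --> \oo] --> a n * (1 * \prod_(i < d) (1 : R)).
  by rewrite big1 // !mulr1; exact.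
by apply: cvgM; [exact: cvg_cst|apply: cvgM => //; exact: cvg_ffact_quotient].
Qed.

Lemma ffact_le_exp N n : (N ^_ n <= N ^ n)%N.
Proof.
rewrite ffact_prod -[n in (N ^ n)%N]card_ord -prod_nat_const.
by apply: leq_prod => i _; exact: leq_subr.
Qed.

(** With M = N+1: for n > M the falling factorial vanishes, and for j < n <= M one has alpha_i + 1 +
    M + j <= (alpha_i + 3) M. The bound does not depend on N, as [tannery] requires. *)
Lemma coef_approximant_bound N n :
  `|(approximant N)`_n| <= `|a n| * (\prod_(i < d) (alpha i + 3)) ^+ n.
Proof.
have M0 : 0 < N.+1%:R ^+ n :> R by rewrite exprn_gt0.
have a3 i : 0 < alpha i + 3 by have := alpha_gtN1 i; lra.
rewrite coef_approximant normrM ler_wpM2l // normrM.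
have [Nn|nN] := ltnP N.+1 n.
  by rewrite ffact_small // mul0r normr0 mul0r exprn_ge0 // prodr_ge0 // => i _; exact: ltW.
rewrite -[leRHS]mul1r; apply: ler_pM => //.
  by rewrite ger0_norm ?divr_ge0 ?(ltW M0) // ler_pdivrMr // mul1r -natrX ler_nat
    ffact_le_exp.
rewrite normr_prod -prodrXl; apply: ler_prod => i _; rewrite normr_ge0 /=.
rewrite ger0_norm; last first.
  by rewrite divr_ge0 ?(ltW M0) // ltW // pochhammer_gt0 // addr_gt0.
rewrite ler_pdivrMr // -exprMn /pochhammer -[n in _ ^+ n]card_ord -prodr_const.
apply: ler_prod => j _; apply/andP; split; first by rewrite addr_ge0 // addr_ge0 // ltW.
have jM : j%:R <= N.+1%:R :> R by rewrite ler_nat (leq_trans _ nN) // ltnW.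
have M1 : 1 <= N.+1%:R :> R by rewrite ler1n.
by have := alpha1_gt0 i; nra.
Qed.

Lemma size_approximant N : (size (approximant N) <= N.+2)%N.
Proof.
apply/leq_sizeP => n Nn; apply/normr0_eq0; rewrite coef_approximant.
by rewrite ffact_small // mul0r mul0r mulr0 normr0.
Qed.

(** Taking x^n, n x^n, n^2 x^n, Re z^n or Im z^n for [e n] gives all the limits needed for the
    approximants. *)
Lemma cvg_approximant_functional (e : nat -> R) c r : (forall n, `|e n| <= c * r ^+ n) ->
  \sum_(n < N.+2) (approximant N)`_n * e n @[N --> \oo] -->
  limn (series (fun n => a n * e n)).
Proof.
move=> er; pose q := \prod_(i < d) (alpha i + 3).
have cA : cvgn (series (fun n => c * (`|a n| * (q * r) ^+ n))).
  rewrite (_ : series _ = fun N => c * pseries (fun n => `|a n|) (q * r) N).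
    by apply: is_cvgM; [exact: is_cvg_cst|exact: (@entire_norm _ _ entire_hyperBessel)].
  by apply/funext => n; rewrite /pseries /series /= mulr_sumr.
rewrite (_ : (fun N => _) = fun N => series (fun n => (approximant N)`_n * e n) N.+2);
  last first.
  by apply/funext => N; rewrite /series /= big_mkord.
apply: (tannery (A := fun n => c * (`|a n| * (q * r) ^+ n)) (h := fun N => N.+2)) => //.
- move=> N n; rewrite normrM.
  apply: le_trans (ler_pM _ _ (coef_approximant_bound N n) (er n)) _ => //.
  by rewrite exprMn -/q le_eqVlt; apply/orP; left; apply/eqP; ring.
- by move=> n; apply: cvgM; [exact: cvg_coef_approximant|exact: cvg_cst].
- by move=> N; rewrite leqW.
Qed.

End HyperBesselCoef.
End Coefficients.

(** * The polynomial inequalities in the limit *)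

Section LimitInequalities.
Variables (R : realType) (d : nat) (alpha : 'I_d -> R).
Hypothesis alpha_gtN1 : forall i, -1 < alpha i.
Implicit Types (x y : R).
Import complex.ComplexField.Normc.
Local Notation a := (hyperBessel_coef alpha).
Local Notation P := (approximant alpha).
Local Notation f := (psum a).
Local Notation f1 := (psum (theta a)).
Local Notation f2 := (psum (theta (theta a))).
Local Notation toC := (map_poly (real_complex R)).

Let functional_cvg e c r := @cvg_approximant_functional R d alpha alpha_gtN1 e c r.

Lemma cvg_approximant x : (P N).[x] @[N --> \oo] --> f x.
Proof.
under eq_fun => N do rewrite (horner_coef_wide _ (size_approximant alpha_gtN1 N)).
by apply: (@functional_cvg _ 1 `|x|) => n; rewrite mul1r normrX.
Qed.

Lemma size_theta (p : {poly R}) n : (size p <= n)%N -> (size ('X * p^`())%R <= n)%N.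
Proof.
move=> /leq_sizeP pn; apply/leq_sizeP => j /pn pj.
by rewrite coef_theta pj mulr0.
Qed.

Lemma cvg_approximant_theta x : ('X * (P N)^`()).[x] @[N --> \oo] --> f1 x.
Proof.
under eq_fun => N do rewrite (horner_coef_wide _ (size_theta (size_approximant alpha_gtN1
  N))).
rewrite /psum /pseries (_ : (fun n => theta a n * x ^+ n) = fun n => a n * (n%:R * x ^+
  n)); last first.
  by apply/funext => n; rewrite /theta; ring.
rewrite (_ : (fun N => \sum_(i < N.+2) ('X * (P N)^`())`_i * x ^+ i) =
  fun N => \sum_(n < N.+2) (P N)`_n * (n%:R * x ^+ n)); last first.
  by apply/funext => N; apply: eq_bigr => i _; rewrite coef_theta; ring.
apply: (@functional_cvg _ 1 (2 * `|x|)) => n.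
by rewrite mul1r normrM normrX exprMn ler_wpM2r ?exprn_ge0 // normr_nat natr_le_exp2.
Qed.

Lemma cvg_approximant_theta2 x :
  ('X * ('X * (P N)^`())^`()).[x] @[N --> \oo] --> f2 x.
Proof.
under eq_fun => N do rewrite (horner_coef_wide _ (size_theta (size_theta
  (size_approximant alpha_gtN1 N)))).
rewrite /psum /pseries (_ : (fun n => theta (theta a) n * x ^+ n) = fun n => a n * (n%:R
  * n%:R * x ^+ n)); last first.
  by apply/funext => n; rewrite /theta; ring.
rewrite (_ : (fun N => \sum_(i < N.+2) ('X * ('X * (P N)^`())^`())`_i * x ^+ i) =
  fun N => \sum_(n < N.+2) (P N)`_n * (n%:R * n%:R * x ^+ n)); last first.
  by apply/funext => N; apply: eq_bigr => i _; rewrite !coef_theta; ring.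
apply: (@functional_cvg _ 1 (4 * `|x|)) => n.
rewrite mul1r !normrM normrX exprMn ler_wpM2r ?exprn_ge0 // normr_nat.
by rewrite (_ : 4 = 2 * 2) ?exprMn ?ler_pM ?natr_le_exp2 // -natrM.
Qed.

Lemma cvg_approximant_complex z :
  complex.Re (toC (P N)).[z] @[N --> \oo] --> complex.Re (cpsum a z : R[i]) /\
  complex.Im (toC (P N)).[z] @[N --> \oo] --> complex.Im (cpsum a z : R[i]).
Proof.
have H N : (toC (P N)).[z] = \sum_(i < N.+2) ((P N)`_i)%:C * z ^+ i.
  rewrite (@horner_coef_wide _ N.+2); last by rewrite size_map_poly size_approximant.
  by apply: eq_bigr => i _; rewrite coef_map.
have [_ ->] := cpsum_cvg z (entire_hyperBessel alpha_gtN1); split.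
  under eq_fun do rewrite H Re_sum; under eq_fun do under eq_bigr do rewrite ReZ.
  by apply: (@functional_cvg _ 1 (normc z)) => n; rewrite mul1r -normcX Re_le_normc.
under eq_fun do rewrite H Im_sum; under eq_fun do under eq_bigr do rewrite ImZ.
by apply: (@functional_cvg _ 1 (normc z)) => n; rewrite mul1r -normcX Im_le_normc.
Qed.

Let s := (\prod_(i < d) (alpha i + 1))^-1.

(** The limit of [positive_rooted_laguerre]: minus the linear coefficient of [P N] tends to [s],
    which is minus the linear coefficient of f. *)
Lemma hyperBessel_laguerre x : 0 <= x ->
  x * s * f x ^+ 2 <= (1 + x * s) ^+ 2 * (f1 x ^+ 2 - f x * f2 x).
Proof.
move=> x0.
have cs : - (P N)`_1 @[N --> \oo] --> s.
  by rewrite -[s]opprK -hyperBessel_coef1; apply: cvgN; exact: cvg_coef_approximant.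
have H N := positive_rooted_laguerre x0 (approximant_positive_rooted alpha_gtN1 N).
have [[c0 c1] c2] := (@cvg_approximant x, @cvg_approximant_theta x,
  @cvg_approximant_theta2 x).
have cL : x * (- (P N)`_1) * ((P N).[x] * (P N).[x]) @[N --> \oo] --> x * s * (f x * f x).
  by apply: cvgM; [apply: cvgM; [exact: cvg_cst|exact: cs]|exact: cvgM].
have cxs : 1 + x * (- (P N)`_1) @[N --> \oo] --> 1 + x * s.
  by apply: cvgD; [exact: cvg_cst|apply: cvgM; [exact: cvg_cst|exact: cs]].
have cR : (1 + x * (- (P N)`_1)) * (1 + x * (- (P N)`_1)) *
    (('X * (P N)^`()).[x] * ('X * (P N)^`()).[x] -
     (P N).[x] * ('X * ('X * (P N)^`())^`()).[x]) @[N --> \oo] -->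
    (1 + x * s) * (1 + x * s) * (f1 x * f1 x - f x * f2 x).
  by apply: cvgM; [exact: cvgM|apply: cvgB; exact: cvgM].
by rewrite !expr2; apply: (ler_cvg_to cL cR); apply: nearW => N; rewrite -!expr2; exact: H.
Qed.

(** The squared moduli of [P N] at the zero tend to 0. In the limit the first bound of
    [positive_rooted_normsq] gives f(x)^2 <= 0, and the second then reduces to (y theta f(x))^2 <=
    0. *)
Lemma hyperBessel_complex_zero x y : cpsum a (x +i* y) = 0 ->
  f x = 0 /\ y * f1 x = 0.
Proof.
move=> F0; have [] := cvg_approximant_complex (x +i* y); rewrite F0 /= => cr ci.
have [[c0 c1] c2] := (@cvg_approximant x, @cvg_approximant_theta x,
  @cvg_approximant_theta2 x).
have H N := positive_rooted_normsq x y (approximant_positive_rooted alpha_gtN1 N).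
pose n N := complex.Re (toC (P N)).[x +i* y] ^+ 2 + complex.Im (toC (P N)).[x +i* y] ^+ 2.
have cn : n N @[N --> \oo] --> (0 : R).
  rewrite -[0](_ : 0 * 0 + 0 * 0 = 0); last by rewrite !mulr0 addr0.
  by apply: cvgD; apply: cvgM.
have f0 : f x = 0.
  have cp : (P N).[x] * (P N).[x] @[N --> \oo] --> f x * f x by exact: cvgM.
  have : f x * f x <= 0.
    by apply: (ler_cvg_to cp cn); apply: nearW => N; rewrite -expr2; case: (H N).
  by move=> h; apply/eqP; rewrite -sqrf_eq0 eq_le expr2 h -expr2 sqr_ge0.
split => //.
have cL : x ^+ 2 * ((P N).[x] * (P N).[x]) + y ^+ 2 *
   (('X * (P N)^`()).[x] * ('X * (P N)^`()).[x] - (P N).[x] *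
     (('X * ('X * (P N)^`())^`()).[x] - ('X * (P N)^`()).[x])) @[N --> \oo] -->
   x ^+ 2 * (f x * f x) + y ^+ 2 * (f1 x * f1 x - f x * (f2 x - f1 x)).
  apply: cvgD; first by apply: cvgM; [exact: cvg_cst|exact: cvgM].
  apply: cvgM; first exact: cvg_cst.
  by apply: cvgB; [exact: cvgM|apply: cvgM => //; exact: cvgB].
have cR : x ^+ 2 * n N @[N --> \oo] --> x ^+ 2 * 0.
  by apply: cvgM => //; exact: cvg_cst.
have : x ^+ 2 * (f x * f x) + y ^+ 2 * (f1 x * f1 x - f x * (f2 x - f1 x)) <= x ^+ 2 * 0.
  by apply: (ler_cvg_to cL cR); apply: nearW => N; rewrite -!expr2; case: (H N).
rewrite f0 !(mul0r, mulr0) add0r subr0 -expr2 -exprMn => h.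
by apply/eqP; rewrite -sqrf_eq0 eq_le h sqr_ge0.
Qed.

End LimitInequalities.

(** * Zeros of the series *)

Section Zeros.
Variable R : realType.
Implicit Types (x y r t : R) (a b : nat -> R) (d : nat).

Lemma psum_comb a b r t x : entire a -> entire b ->
  psum (fun n => r * a n + t * b n) x = r * psum a x + t * psum b x.
Proof.
move=> ea eb; apply: cvg_lim => //.
rewrite (_ : pseries _ _ = fun N => r * pseries a x N + t * pseries b x N).
  by apply: cvgD; (apply: cvgM; [exact: cvg_cst|]); [exact: ea|exact: eb].
apply/funext => N; rewrite /pseries /series /= !mulr_sumr -big_split /=.
by apply: eq_bigr => i _; ring.
Qed.

Lemma psum_bound a b c x : entire b ->
  (forall n, `|a n| <= c * `|b n|) -> `|psum a x| <= c * psum (fun n => `|b n|) `|x|.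
Proof.
move=> eb ab; have nb := @entire_norm _ _ eb `|x|.
have cA : series (fun n => c * (`|b n| * `|x| ^+ n)) N @[N --> \oo] -->
    c * psum (fun n => `|b n|) `|x|.
  rewrite (_ : series _ = fun N => c * pseries (fun n => `|b n|) `|x| N).
    by apply: cvgM; [exact: cvg_cst|exact: nb].
  by apply/funext => N; rewrite /pseries /series /= mulr_sumr.
have aA n : `|a n * x ^+ n| <= c * (`|b n| * `|x| ^+ n).
  by rewrite normrM normrX mulrA ler_wpM2r ?exprn_ge0.
have := dominated_tail 0 aA (cvgP _ cA).
by rewrite (cvg_lim _ cA) // /series /= !big_geq // !subr0.
Qed.

Definition raise d (alpha : 'I_d -> R) (i0 : 'I_d) (i : 'I_d) : R := alpha i + (i == i0)%:R.

(** * Effect of raising one parameter by 1 *)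

Section OneParameter.
Variables (d : nat) (alpha : 'I_d -> R).
Hypothesis alpha_gtN1 : forall i, -1 < alpha i.
Variable i0 : 'I_d.
Local Notation a := (hyperBessel_coef alpha).
Local Notation b := (hyperBessel_coef (raise alpha i0)).
Let c := alpha i0 + 1.

Let c_gt0 : 0 < c.
Proof. by rewrite /c -ltrBlDr sub0r. Qed.

Lemma raise_gtN1 i : -1 < raise alpha i0 i.
Proof. by rewrite ltr_wpDr. Qed.

Lemma psum_raise x : psum (theta b) x + c * psum b x = c * psum a x.
Proof.
have ea := entire_hyperBessel alpha_gtN1; have eb := entire_hyperBessel raise_gtN1.
have := psum_comb 1 c x (entire_theta eb) eb; rewrite mul1r => <-.
have := psum_comb c 0 x ea ea; rewrite mul0r addr0 => <-.
congr psum; apply/funext => n; rewrite mul1r mul0r addr0 /theta -mulrDl.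
exact: hyperBessel_coef_bump.
Qed.

Lemma psum_theta_raise x :
  psum (theta (theta b)) x + c * psum (theta b) x = c * psum (theta a) x.
Proof.
have ea := entire_hyperBessel alpha_gtN1; have eb := entire_hyperBessel raise_gtN1.
have := psum_comb 1 c x (entire_theta (entire_theta eb)) (entire_theta eb).
rewrite mul1r => <-.
have := psum_comb c 0 x (entire_theta ea) (entire_theta ea); rewrite mul0r addr0 => <-.
congr psum; apply/funext => n; rewrite mul1r mul0r addr0 /theta.
have : (n%:R + c) * b n = c * a n := hyperBessel_coef_bump alpha_gtN1 i0 n.
move: (b n) (a n) => u v e; rewrite [RHS]mulrCA -e; ring.
Qed.

(* With [theta g + c g = c f], a double zero of [f] makes the Laguerre
   expression of [g] vanish, hence is a double zero of [g] too. *)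
Lemma double_zero_raise x : 0 < x -> psum a x = 0 -> psum (theta a) x = 0 ->
  psum b x = 0 /\ psum (theta b) x = 0.
Proof.
move=> x0 f0 f1.
have := psum_raise x; rewrite f0 mulr0 => /eqP; rewrite addr_eq0 => /eqP g1.
have := psum_theta_raise x; rewrite f1 mulr0 => /eqP; rewrite addr_eq0 => /eqP g2.
suff g0 : psum b x = 0 by rewrite g1 g0 mulr0 oppr0.
have := hyperBessel_laguerre raise_gtN1 (ltW x0); rewrite g2 g1.
set s := (\prod_(i < d) _)^-1.
have s0 : 0 < s by rewrite invr_gt0 prodr_gt0 // => i _; rewrite -ltrBlDr sub0r raise_gtN1.
rewrite (_ : _ - _ = 0); last by ring.
rewrite mulr0 pmulr_rle0 ?mulr_gt0 // => h.
by apply/eqP; rewrite -sqrf_eq0 eq_le h sqr_ge0.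
Qed.

(** The contiguity relation with n + c >= 1 + c. Iterated over successive raises, the bound
    telescopes and makes every coefficient but the constant one tend to 0. *)
Lemma coef_raise_bound n : (0 < n)%N -> (c + 1) * `|b n| <= c * `|a n|.
Proof.
move=> n0; have /(congr1 Num.norm) := hyperBessel_coef_bump alpha_gtN1 i0 n.
rewrite !normrM -/c (gtr0_norm c_gt0) => <-.
rewrite ler_wpM2r // (le_trans _ (ler_norm _)) // addrC lerD2r.
by rewrite ler1n.
Qed.

End OneParameter.

Lemma iter_raise d (alpha : 'I_d -> R) (i0 : 'I_d) k i :
  iter k (fun al => raise al i0) alpha i = alpha i + ((i == i0) * k)%:R.
Proof.
elim: k => [|k IH] /=; first by rewrite muln0 addr0.
by rewrite /raise IH mulnS natrD [(i == i0)%:R + _]addrC addrA.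
Qed.

(** * Simplicity and positivity of the zeros, and their separation *)

Section ZerosOnRays.
Variables (d : nat) (alpha : 'I_d -> R).
Hypotheses (alpha_gtN1 : forall i, -1 < alpha i) (d_gt0 : (0 < d)%N).
Local Notation a := (hyperBessel_coef alpha).

Lemma psum_simple_zero x : 0 < x -> psum a x = 0 -> psum (theta a) x != 0.
Proof.
move=> x0 f0; apply/eqP => f1; pose i0 := Ordinal d_gt0.
pose al k := iter k (fun al => raise al i0) alpha; pose ak k := hyperBessel_coef (al k).
have al_gt k i : -1 < al k i by rewrite /al iter_raise ltr_wpDr.
have zero k : psum (ak k) x = 0 /\ psum (theta (ak k)) x = 0.
  by elim: k => // k [z0 z1]; apply: (double_zero_raise (al_gt k)).
pose c := alpha i0 + 1.
have c0 : 0 < c by rewrite /c -ltrBlDr sub0r.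
have bound k n : (0 < n)%N -> (c + k%:R) * `|ak k n| <= c * `|a n|.
  move=> n0; elim: k => [|k IH]; first by rewrite addr0.
  have ck : c + k%:R = al k i0 + 1 by rewrite /al iter_raise eqxx mul1n addrAC.
  apply: le_trans IH; rewrite -natr1 addrA ck.
  exact: coef_raise_bound (al_gt k) i0 n n0.
(* The coefficients of the constant 1, to which the raised functions f_k are compared. *)
pose delta (n : nat) : R := (n == 0%N)%:R.
have ea := entire_hyperBessel alpha_gtN1.
have ed : entire delta.
  apply: (@entire_growth _ _ _ 1 ea) => n; rewrite expr1n mulr1 /delta.
  by case: n => [|n] //=; rewrite ?hyperBessel_coef0 // normr0.
have d1 : psum delta x = 1.
  apply: cvg_lim => //; rewrite -cvg_shiftS.
  rewrite (_ : (fun _ => _) = cst 1); first exact: cvg_cst.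
  apply/funext => n; rewrite /pseries /series /= big_nat_recl // expr0 mulr1 big1 ?addr0
    // => i _.
  by rewrite mul0r.
pose S := psum (fun n => `|a n|) `|x|.
(* All f_k vanish at x, while [bound] gives |f_k(x) - 1| <= c S / (c + k). So c + k stays below c S,
   against the Archimedean property. *)
have H k : c + k%:R <= c * S.
  have ck : 0 < c + k%:R by rewrite ltr_wpDr.
  have := psum_bound x ea (_ : forall n, `|1 * ak k n + (-1) * delta n| <= c / (c + k%:R)
    * `|a n|).
  rewrite psum_comb //; last exact: entire_hyperBessel.
  rewrite (zero k).1 d1 mulr0 add0r mulr1 normrN1 mulrAC ler_pdivlMr // mul1r; apply.
  case=> [|n]; rewrite /delta /= ?mulr1 ?mulr0 ?addr0 mul1r.
    by rewrite /ak hyperBessel_coef0 subrr normr0 mulr_ge0 // divr_ge0 // ltW.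
  by rewrite mulrAC ler_pdivlMr // mulrC bound.
have S0 : 0 <= c * S by apply: le_trans (H 0%N); rewrite addr0 ltW.
have := archi_boundP S0; apply/negP; rewrite -leNgt.
by apply: le_trans (H (Num.bound (c * S))); rewrite lerDr ltW.
Qed.

(** The alternating signs cancel for x <= 0: all terms are nonnegative and the first is 1. *)
Lemma psum_gt0 x : x <= 0 -> 0 < psum a x.
Proof.
move=> x0; have ea := entire_hyperBessel alpha_gtN1.
have aE n : a n * x ^+ n = `|a n| * (- x) ^+ n.
  rewrite (normr_hyperBessel_coef alpha_gtN1) /hyperBessel_coef.
  by rewrite mulrAC [RHS]mulrC -exprMn mulN1r.
have -> : psum a x = limn (pseries (fun n => `|a n|) (- x)).
  by rewrite /psum /pseries; under eq_fun do rewrite aE.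
apply: (@lt_le_trans _ _ (pseries (fun n => `|a n|) (- x) 1)).
  by rewrite /pseries /series /= big_nat1 hyperBessel_coef0 normr1 expr0 mulr1.
apply: nondecreasing_cvgn_le; last exact: entire_norm.
by apply: nondecreasing_series => n _ _; rewrite mulr_ge0 ?exprn_ge0 // oppr_ge0.
Qed.

(** The real part x is itself a zero of f, hence positive, and its simplicity forces y = 0. *)
Lemma cpsum_zero_real z : cpsum a z = 0 -> exists2 x, 0 < x & z = x%:C.
Proof.
case: z => x y /(hyperBessel_complex_zero alpha_gtN1)[f0 /eqP].
have x0 : 0 < x by rewrite ltNge; apply/negP => /psum_gt0; rewrite f0 ltxx.
rewrite mulf_eq0 (negPf (psum_simple_zero x0 f0)) orbF => /eqP ->.
by exists x.
Qed.

Lemma psum_no_common_zero x : psum a x = 0 -> psum (theta a) x = 0 -> False.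
Proof.
move=> f0 /eqP; apply/negP/psum_simple_zero => //.
by rewrite ltNge; apply/negP => /psum_gt0; rewrite f0 ltxx.
Qed.

Let ea : entire a := entire_hyperBessel alpha_gtN1.

(* [theta f / f] is strictly decreasing where [f] does not vanish. *)
Lemma psum_theta_zero_between x y : 0 <= x -> x < y ->
  psum (theta a) x = 0 -> psum (theta a) y = 0 ->
  exists2 t, x < t < y & psum a t = 0.
Proof.
move=> x0 xy f1x f1y; apply: contrapT => nz.
(* At the endpoints theta f vanishes, so f does not. *)
have nz' t : x <= t <= y -> psum a t != 0.
  move=> /andP[]; rewrite le_eqVlt => /orP[/eqP <- _|xt].
    by apply/eqP => f0; exact: psum_no_common_zero f0 f1x.
  rewrite le_eqVlt => /orP[/eqP -> |ty].
    by apply/eqP => f0; exact: psum_no_common_zero f0 f1y.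
  by apply/eqP => f0; apply: nz; exists t => //; rewrite xt.
pose psi t := psum (theta a) t * (psum a t)^-1.
have D t : x <= t <= y -> is_derive t 1 psi
   (psum (theta a) t *: (- (psum a t) ^- 2 *: psum (pseries_diffs a) t) +
    (psum a t)^-1 *: psum (pseries_diffs (theta a)) t).
  move=> txy; have D0 := is_derive_psum t ea; have D1 := is_derive_psum t (entire_theta ea).
  have D2 : is_derive t 1 (fun u => (psum a u)^-1)
      (- (psum a t) ^- 2 *: psum (pseries_diffs a) t).
    apply: DeriveDef; first by apply: derivableV; [exact: nz'|case: D0].
    by rewrite deriveV; [rewrite derive_val|exact: nz'|case: D0].
  exact: is_deriveM D1 D2.
have [|||t] := @Rolle _ psi _ _ xy.
- by move=> t; rewrite in_itv /= => /andP[xt ty]; case: (D t); rewrite ?ltW.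
- apply: derivable_within_continuous => t; rewrite in_itv /= => txy.
  by case: (D t txy).
- by rewrite /psi f1x f1y !mul0r.
rewrite in_itv /= => /andP[xt ty] dt.
have txy : x <= t <= y by rewrite !ltW.
have t0 : 0 < t := le_lt_trans x0 xt.
have := @derive_val _ _ _ _ _ _ _ (D t txy); rewrite (@derive_val _ _ _ _ _ _ _ dt).
have := hyperBessel_laguerre alpha_gtN1 (ltW t0).
rewrite !psum_theta //; last exact: entire_theta.
rewrite /GRing.scale /=.
set s := (\prod_(i < d) _)^-1.
have s0 : 0 < s by rewrite invr_gt0 prodr_gt0 // => i _; rewrite -ltrBlDr sub0r alpha_gtN1.
have := nz' t txy; move: (psum a t) (psum (pseries_diffs a) t) (psum (pseries_diffs
  (theta a)) t).
move=> F F' G F0 H e.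
(* The vanishing of psi' at t, cleared of denominators. It annihilates the right-hand side of the
   Laguerre inequality, whose left-hand side is positive. *)
have {}e : F * G - t * F' ^+ 2 = 0.
  apply: (mulfI (expf_neq0 2 (invr_neq0 F0))); rewrite mulr0 e; field.
  exact: F0.
have : 0 < t * s * F ^+ 2 by apply: mulr_gt0; [exact: mulr_gt0|rewrite exprn_even_gt0].
rewrite (_ : (t * F') ^+ 2 - F * (t * G) = - t * (F * G - t * F' ^+ 2)) in H; last by ring.
by rewrite e !mulr0 in H; rewrite ltNge H.
Qed.

End ZerosOnRays.
End Zeros.

(** * Interlacing on the lines *)

Section Interlacing.
Variables (R : realType) (d : nat) (alpha : 'I_d -> R).
Hypotheses (alpha_gtN1 : forall i, -1 < alpha i) (d_gt0 : (0 < d)%N).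
Implicit Types (x y r s t : R) (z w : R[i]).
Import complex.ComplexField.Normc.
Local Notation a := (hyperBessel_coef alpha).
Local Notation m := d.+1.

Let ea : entire a := entire_hyperBessel alpha_gtN1.

(** Two points of [B] in the gap would enclose a point of [A] lying in the gap. *)
Lemma consecutive_unique (A B : set R) x y :
  (forall x y, x < y -> A x -> A y -> exists2 t, x < t < y & B t) ->
  (forall x y, x < y -> B x -> B y -> exists2 t, x < t < y & A t) ->
  consecutive A x y -> exists! t, x < t < y /\ B t.
Proof.
move=> AB BA [Ax Ay xy nA].
have nB t u : x < t < y -> x < u < y -> B t -> B u -> ~ t < u.
  move=> /andP[xt _] /andP[_ uy] Bt Bu tu; have [v /andP[tv vu] Av] := BA t u tu Bt Bu.
  by apply: (nA v) Av; rewrite (lt_trans xt tv) (lt_trans vu uy).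
have [t txy Bt] := AB x y xy Ax Ay; exists t; split=> // u [uxy Bu].
by have [/(nB t u txy uxy Bt Bu)|/(nB u t uxy txy Bu Bt)|] := ltgtP t u.
Qed.

Lemma interlacedI (A B : set R) : A `&` B = set0 ->
  (forall x y, x < y -> A x -> A y -> exists2 t, x < t < y & B t) ->
  (forall x y, x < y -> B x -> B y -> exists2 t, x < t < y & A t) ->
  interlaced A B.
Proof. by move=> AB0 AB BA; split=> // x y; exact: consecutive_unique. Qed.

Lemma is_derive1_comp_field (K : numFieldType) (f g : K^o -> K^o) (x : K^o) (df dg : K) :
  is_derive (g x) 1 f df -> is_derive x 1 g dg -> is_derive x 1 (f \o g) (dg * df).
Proof.
move=> [Df <-] [Dg <-].
have Df' := iffLR (derivable1_diffP _ _) Df.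
have Dg' := iffLR (derivable1_diffP _ _) Dg.
have D := differentiable_comp Dg' Df'.
apply: DeriveDef; first exact: (iffRL (derivable1_diffP _ _) D).
rewrite deriveE; last exact: D.
apply: etrans (congr1 (fun h : K^o -> K^o => h 1) (diff_comp Dg' Df')) _.
rewrite -[LHS]/('d f (g x) ('d g x 1)).
apply: etrans (congr1 (fun h : K^o -> K^o => h ('d g x 1)) (deriv1E Df)) _.
rewrite derive1E.
by rewrite (deriveE (1 : K^o) Dg').
Qed.

(** Stated over any numeric field, as it serves both the complex derivative and Rolle's theorem on
    the real line. *)
Lemma is_derive_scaled_power (K : numFieldType) n (x : K^o) :
  is_derive x 1 (fun u : K^o => (u / n.+1%:R) ^+ n.+1 : K^o) ((x / n.+1%:R) ^+ n).
Proof.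
have D : is_derive x 1 (fun u : K^o => u / n.+1%:R : K^o) (n.+1%:R^-1).
  have := @is_deriveM _ _ (@id K^o) (cst n.+1%:R^-1) x 1 _ _ (is_derive_id _ _)
    (is_derive_cst _ _ _).
  by rewrite scaler0 add0r /GRing.scale /= mulr1.
have := is_deriveX n.+1 D; rewrite exprfctE /= => /is_derive_eq; apply.
by rewrite /GRing.scale /= mulrAC mulfV ?mul1r // pnatr_eq0.
Qed.

Lemma hyperBesselE z : hyperBessel alpha z = cpsum a ((z / m%:R) ^+ m).
Proof.
rewrite /hyperBessel /cpsum; congr (limn (series _)); apply/funext => n.
by rewrite -exprM mulnC.
Qed.

Lemma derive1_hyperBessel z : derive1 (hyperBessel alpha) z =
  (z / m%:R) ^+ d * cpsum (pseries_diffs a) ((z / m%:R) ^+ m).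
Proof.
have -> : hyperBessel alpha = cpsum a \o (fun u : R[i]^o => (u * m%:R^-1) ^+ m : R[i]^o).
  by apply/funext => u; exact: hyperBesselE.
have D := @is_derive_scaled_power R[i] d z.
rewrite derive1E.
exact: (@derive_val _ _ _ _ _ _ _ (is_derive1_comp_field (is_derive_cpsum _ ea) D)).
Qed.

Lemma cpsum_diffs_zero_real z : cpsum (pseries_diffs a) z = 0 ->
  exists2 x, 0 < x & z = x%:C.
Proof.
pose b := hyperBessel_coef (fun i => alpha i + 1).
have alpha1 i : -1 < alpha i + 1 by rewrite ltr_wpDr.
pose q := - (\prod_(i < d) (alpha i + 1))^-1.
have q0 : q != 0.
  rewrite oppr_eq0 invr_eq0 gt_eqF // prodr_gt0 // => i _.
  by rewrite -ltrBlDr sub0r.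
have -> : cpsum (pseries_diffs a) z = q%:C * cpsum b z.
  have eb : entire b := entire_hyperBessel alpha1.
  apply: cvg_lim; first exact: norm_hausdorff.
  rewrite (_ : series _ = fun N => q%:C * series (fun n => (b n)%:C * z ^+ n : R[i]^o) N).
    by apply: cvgM; [exact: cvg_cst|case: (cpsum_cvg z eb)].
  apply/funext => N; rewrite /series /= mulr_sumr; apply: eq_bigr => n _.
  by rewrite hyperBessel_coef_diffs mulrA -rmorphM.
move=> /eqP; rewrite mulf_eq0 fmorph_eq0 (negPf q0) /= => /eqP.
exact: (cpsum_zero_real alpha1 d_gt0).
Qed.

Lemma power_ray (t : R) w : w ^+ m = 1 ->
  (t%:C * w / m%:R) ^+ m = ((t / m%:R) ^+ m)%:C.
Proof.
move=> wm; rewrite mulrAC exprMn wm mulr1 rmorphXn rmorphM fmorphV rmorph_nat.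
exact.
Qed.

Lemma natm_gt0 : 0 < m%:R :> R. Proof. by rewrite ltr0n. Qed.

Lemma hyperBessel_ray t w : w ^+ m = 1 ->
  hyperBessel alpha (t%:C * w) = 0 <-> psum a ((t / m%:R) ^+ m) = 0.
Proof.
move=> wm; rewrite hyperBesselE power_ray // cpsum_real //; split=> [|->//].
by case.
Qed.

(** At t = 0 both sides hold, since d >= 1; elsewhere the prefactors (z/m)^d and u are nonzero, and
    both sides say f'(u) = 0. *)
Lemma derive1_hyperBessel_ray t w : w ^+ m = 1 ->
  derive1 (hyperBessel alpha) (t%:C * w) = 0 <->
  psum (theta a) ((t / m%:R) ^+ m) = 0.
Proof.
move=> wm; rewrite derive1_hyperBessel power_ray // cpsum_real; last exact: entire_diffs.
have w0 : w != 0 by apply: contra_eq_neq wm => ->; rewrite expr0n /= eq_sym oner_eq0.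
have mC : (m%:R : R[i]) != 0 by rewrite pnatr_eq0.
rewrite psum_theta //; split=> /eqP; rewrite mulf_eq0 => /orP[|]/eqP h; apply/eqP;
  rewrite mulf_eq0; apply/orP.
- left; move/eqP: h; rewrite expf_eq0 d_gt0 /= !mulf_eq0 invr_eq0 (negPf mC) (negPf w0)
  !orbF.
  by rewrite fmorph_eq0 => /eqP ->; rewrite mul0r expr0n.
- by right; case: h => ->.
- left; move/eqP: h; rewrite expf_eq0 /= mulf_eq0 invr_eq0 pnatr_eq0 orbF => /eqP ->.
  by rewrite !mul0r expr0n eqn0Ngt d_gt0.
- by right; rewrite h.
Qed.

Lemma power_eq_real z x : 0 < x -> (z / m%:R) ^+ m = x%:C ->
  exists t w, w ^+ m = 1 /\ z = t%:C * w.
Proof.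
move=> x0 zx.
have z0 : z != 0.
  apply: contra_eq_neq zx => ->; rewrite mul0r expr0n /= eq_sym fmorph_eq0 gt_eqF //.
have n0 : (normc z)%:C != 0 by rewrite -normrcE normr_eq0.
(* Since z^m is positive, it equals |z|^m, so z / |z| is an m-th root of unity. *)
exists (normc z), (z / (normc z)%:C); split; last by rewrite mulrC divfK.
have zm : z ^+ m = (x * m%:R ^+ m)%:C.
  rewrite rmorphM /= -zx rmorphXn rmorph_nat -exprMn divfK // pnatr_eq0 //.
rewrite expr_div_n -normrcE -normrX zm ger0_norm ?mulfV //.
  by rewrite fmorph_eq0 gt_eqF // mulr_gt0 // exprn_gt0 // natm_gt0.
by rewrite ler0c ltW // mulr_gt0 // exprn_gt0 // natm_gt0.
Qed.

Lemma zeros_on_lines z :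
  (zeros (derive1 (hyperBessel alpha)) `|` zeros (hyperBessel alpha)) z ->
  exists t w, w ^+ m = 1 /\ z = t%:C * w.
Proof.
case; rewrite /zeros /=.
  rewrite derive1_hyperBessel => /eqP; rewrite mulf_eq0 => /orP[|/eqP].
    rewrite expf_eq0 d_gt0 /= mulf_eq0 invr_eq0 pnatr_eq0 orbF => /eqP ->.
    by exists 0, 1; rewrite expr1n mul0r.
  by move=> /cpsum_diffs_zero_real[x x0]; exact: power_eq_real.
by rewrite hyperBesselE => /(cpsum_zero_real alpha_gtN1 d_gt0)[x x0]; exact: power_eq_real.
Qed.

Local Notation q t := ((t / m%:R) ^+ m).

Lemma scaled_power_lt s t : 0 <= s -> 0 <= t -> (q s < q t) = (s < t).
Proof.
move=> s0 t0; rewrite ltr_pXn2r ?nnegrE ?divr_ge0 //.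
by rewrite ltr_pM2r // invr_gt0 natm_gt0.
Qed.

Lemma scaled_power_onto x : 0 <= x -> exists2 t, 0 <= t & q t = x.
Proof.
move=> x0; exists (x `^ (m%:R^-1) * m%:R).
  by rewrite mulr_ge0 ?powR_ge0.
by rewrite mulfK ?pnatr_eq0 // -powR_mulrn ?powR_ge0 // -powRrM mulVf ?pnatr_eq0 // powRr1.
Qed.

Lemma zero_between_nonneg s t : 0 <= s -> s < t ->
  psum (theta a) (q s) = 0 -> psum (theta a) (q t) = 0 ->
  exists2 r, s < r < t & psum a (q r) = 0.
Proof.
move=> s0 st fs ft; have t0 : 0 <= t by rewrite ltW // (le_lt_trans s0).
have qst : q s < q t by rewrite scaled_power_lt.
have qs0 : 0 <= q s by rewrite exprn_ge0 // divr_ge0.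
have [x /andP[sx xt] fx] := psum_theta_zero_between alpha_gtN1 d_gt0 qs0 qst fs ft.
have [r r0 rx] := scaled_power_onto (ltW (le_lt_trans qs0 sx)).
exists r; last by rewrite rx.
by rewrite -scaled_power_lt // rx sx -scaled_power_lt // rx.
Qed.

Lemma zero_between s t : s < t ->
  psum (theta a) (q s) = 0 -> psum (theta a) (q t) = 0 ->
  exists2 r, s < r < t & psum a (q r) = 0.
Proof.
move=> st fs ft.
have [s0|s0] := leP 0 s; first exact: zero_between_nonneg.
(* If s < 0 < t, the origin is a zero of theta f and can replace s. *)
have [t0|t0] := ltP 0 t.
  have f0 : psum (theta a) (q 0) = 0.
    by rewrite mul0r expr0n /= psum0 /theta mul0r.
  have [r /andP[r0 rt] fr] := zero_between_nonneg (lexx 0) t0 f0 ft.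
  by exists r => //; rewrite rt (lt_trans s0 r0).
(* A negative [s] with [q s > 0] forces [m] to be even. *)
have qs0 : 0 < q s.
  have qs : q s != 0 by rewrite expf_neq0 // mulf_neq0 ?invr_eq0 ?pnatr_eq0 // lt_eqF.
  move: fs; rewrite psum_theta // => /eqP; rewrite mulf_eq0 (negPf qs) /= => /eqP fs.
  have := cpsum_real (q s) (entire_diffs ea); rewrite fs.
  by move=> /cpsum_diffs_zero_real[x x0 /complexI ->].
have odd_m : odd m = false.
  apply: contraTF qs0 => mo; rewrite exprn_odd_gt0; last exact: mo.
  by rewrite -leNgt pmulr_lle0 ?invr_gt0 ?natm_gt0 // ltW.
(* The interval can now be reflected into the nonnegative half-line. *)
have qN u : q (- u) = q u by rewrite mulNr exprNn -signr_odd odd_m expr0 mul1r.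
have [||||r /andP[tr rs] fr] := @zero_between_nonneg (- t) (- s).
- by rewrite oppr_ge0.
- by rewrite ltrN2.
- by rewrite qN.
- by rewrite qN.
exists (- r); last by rewrite qN.
by rewrite ltrNr ltrNl tr rs.
Qed.

Lemma theta_zero_between s t : s < t -> psum a (q s) = 0 -> psum a (q t) = 0 ->
  exists2 r, s < r < t & psum (theta a) (q r) = 0.
Proof.
move=> st fs ft.
pose g (u : R) := (u * m%:R^-1) ^+ m.
have Dg (u : R) : is_derive u 1 g ((u / m%:R) ^+ d) := @is_derive_scaled_power R d u.
have D u := is_derive1_comp (is_derive_psum (g u) ea) (Dg u).
have [|||r] := @Rolle _ (psum a \o g) _ _ st.
- by move=> u _; case: (D u).
- by apply: derivable_within_continuous => u _; case: (D u).
- by rewrite /= fs ft.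
rewrite in_itv /= => rst dr; exists r => //.
have := @derive_val _ _ _ _ _ _ _ (D r); rewrite (@derive_val _ _ _ _ _ _ _ dr)
  psum_theta //.
(* The derivative is the product of (r/m)^d and f'(q r), and theta f at q r is r/m times it; either
   factor may vanish. *)
rewrite exprS -/(g r) => /esym/eqP; rewrite mulf_eq0 => /orP[] /eqP e.
  by rewrite -exprS -/(g r) e mulr0.
by rewrite e mulr0 mul0r.
Qed.

End Interlacing.

Theorem theorem5 (R : realType) (d : nat) (alpha : 'I_d -> R)
    (d_ge1 : (1 <= d)%N) (alpha_gtN1 : forall i : 'I_d, -1 < alpha i) :
  interlaced_on_lines d.+1
    (zeros (derive1 (hyperBessel alpha))) (zeros (hyperBessel alpha)).
Proof.
split=> [z|w w1]; first exact: zeros_on_lines.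
have JE t := hyperBessel_ray alpha_gtN1 t w1.
have J'E t := derive1_hyperBessel_ray alpha_gtN1 d_ge1 t w1.
apply: interlacedI => [|s t st /J'E fs /J'E ft|s t st /JE fs /JE ft].
- by apply/seteqP; split=> // t [/J'E f1 /JE f0]; exact: psum_no_common_zero f0 f1.
- have [r rst fr] := zero_between alpha_gtN1 d_ge1 st fs ft.
  by exists r; [exact: rst|exact/JE].
- have [r rst fr] := theta_zero_between alpha_gtN1 st fs ft.
  by exists r; [exact: rst|exact/J'E].
Qed.
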